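(* Let $F:\mathbb{R}^n\rightrightarrows\mathbb{R}^n$ be a multifunction that satisfies condition $(U)$ (stated in the context), is lower semicontinuous, and has closed, convex, and nonempty values. Let $S\subseteq\mathbb{R}^n$ be closed. Then $(F,S)$ is strongly invariant in $\mathbb{R}^n$ if and only if $H_F(x,N^P_S(x))\le 0$ for all $x\in\mathrm{boundary}(S)$.
   Context: Notation. $\|\cdot\|$ is the Euclidean norm on $\mathbb{R}^n$, and $\langle\cdot,\cdot\rangle$ the Euclidean inner product. For $p\in\mathbb{R}^n$, $\mathcal{B}_n(p)=\{x\in\mathbb{R}^n:\|x-p\|\le 1\}$, and $\gamma\mathcal{B}_n(p)$ denotes the closed ball of radius $\gamma>0$ centered at $p$. For $D\subseteq\mathbb{R}^n$, $\mathrm{cone}\{D\}=\bigcup_{\eta\ge 0}\eta D$. ''A.a.'' means Lebesgue almost all. $F$ is lower semicontinuous (as a multifunction) if $\{x\in\mathbb{R}^n:F(x)\cap O\ne\emptyset\}$ is open for every open $O\subseteq\mathbb{R}^n$. Trajectories. A trajectory of $F$ on $[0,T]$ starting at $x_o$ is an absolutely continuous function $\phi:[0,T]\to\mathbb{R}^n$ with $\phi(0)=x_o$ and $\dot\phi(t)\in F(\phi(t))$ for a.a. $t\in[0,T]$. $\mathrm{Traj}_T(F,x)$ is the set of all trajectories $\phi:[0,T]\to\mathbb{R}^n$ of $F$ starting at $x$. The class $\mathcal{C}[0,T]$. A modulus is a nondecreasing continuous function $\omega:[0,\infty)\to[0,\infty)$ with $\omega(0)=0$. For $T\ge 0$, $\mathcal{C}[0,T]$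 is the set of all functions $f:[0,T]\times\mathbb{R}^n\to\mathbb{R}^n$ such that: (1) for each $x\in\mathbb{R}^n$ the map $t\mapsto f(t,x)$ is measurable; (2) for each compact $K\subseteq\mathbb{R}^n$ there is a modulus $\omega_{f,K}$ such that $\|f(t,x_1)-f(t,x_2)\|\le\omega_{f,K}(\|x_1-x_2\|)$ for all $t\in[0,T]$ and $x_1,x_2\in K$; (3) $f$ has linear growth on $[0,T]$, i.e. there exist positive constants $c_1,c_2$ with $\|f(t,x)\|\le c_1+c_2\|x\|$ for all $t\in[0,T]$, $x\in\mathbb{R}^n$. For $\bar x\in\mathbb{R}^n$, $\mathcal{C}_F([0,T],\bar x)$ is the set of all $f\in\mathcal{C}[0,T]$ for which there exists $\gamma>0$ such that $f(t,x)\in\mathrm{cone}\{F(x)\}$ for a.a. $t\in[0,T]$ and all $x\in\gamma\mathcal{B}_n(\bar x)$. Condition $(U)$: for each $\bar x\in\mathbb{R}^n$, each $T\ge 0$, and each $\phi\in\mathrm{Traj}_T(F,\bar x)$, there exists $f\in\mathcal{C}_F([0,T],\bar x)$ for which $\phi$ is the unique solution of the initial value problem $\dot y(t)=f(t,y(t))$, $y(0)=\bar x$ on $[0,T]$. Hamiltonian. $H_F(x,p)=\sup_{v\in F(x)}\langle v,p\rangle\in[-\infty,+\infty]$. For $D\subseteq\mathbb{R}^n$, $H_F(x,D)\le 0$ means $H_F(x,d)\le 0$ for all $d\in D$. Proximal normals. For closed $S\subseteq\mathbb{R}^n$ and $s\in S$, $N^P_S(s)$ is the set of all $\zeta\in\mathbb{R}^n$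 for which there exists $\sigma=\sigma(\zeta,s)>0$ such that $\langle\zeta,s'-s\rangle\le\sigma\|s'-s\|^2$ for all $s'\in S$. Strong invariance in $\mathbb{R}^n$. For $x_0\in\mathbb{R}^n$ let $\Upsilon(x_0)$ be the set of functions $x(\cdot):[0,T)\to\mathbb{R}^n$, $0<T\le\infty$, absolutely continuous on every compact subinterval of $[0,T)$, with $x(0)=x_0$, $\dot x(t)\in F(x(t))$ for a.a. $t\in[0,T)$, and such that either $T=\infty$ or $\|x(t)\|\to\infty$ as $t\uparrow T$ (that is, $T$ is an escape time of $x(\cdot)$ from $\mathbb{R}^n$). For a closed set $E\subseteq\mathbb{R}^n$, $(F,E)$ is strongly invariant in $\mathbb{R}^n$ if for every $x_0\in E$, every $x(\cdot)\in\Upsilon(x_0)$, with domain $[0,T)$, satisfies $x(t)\in E$ for all $t\in[0,T)$. *)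

(* Defs.v *)
(* R^n is 'rV[R]_n with R : realType. *)
From HB Require Import structures.
From mathcomp Require Import all_boot all_order all_algebra.
From mathcomp Require Import all_classical all_reals all_analysis.

Set Implicit Arguments.
Unset Strict Implicit.
Unset Printing Implicit Defensive.

Import Order.TTheory GRing.Theory Num.Theory.
Import numFieldNormedType.Exports.

Local Open Scope classical_set_scope.
Local Open Scope ring_scope.

Section euclidean.
Context {R : realType} {n : nat}.
Implicit Types (u v x p : 'rV[R]_n) (D S : set 'rV[R]_n).

Definition dot u v : R := \sum_(i < n) u 0 i * v 0 i.

(* The norm `|u| of the library on 'rV[R]_n is the sup norm. The topology on
   'rV[R]_n is the usual one, so open, closed, compact and derivatives are
   those of the library. *)
Definition enorm u : R := Num.sqrt (dot u u).

Definition eball (p : 'rV[R]_n) (g : R) : set 'rV[R]_n :=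
  [set x | enorm (x - p) <= g].

Definition cone D : set 'rV[R]_n :=
  [set w | exists2 eta : R, 0 <= eta & exists2 v, D v & w = eta *: v].

Definition boundary D : set 'rV[R]_n := closure D `\` interior D.

Definition proximal_normal S (s : 'rV[R]_n) : set 'rV[R]_n :=
  [set zeta | exists2 sigma : R, 0 < sigma &
    forall s', S s' -> dot zeta (s' - s) <= sigma * enorm (s' - s) ^+ 2].

End euclidean.

(* Functions on a subinterval of the line are represented by total functions
   whose values outside the interval are irrelevant. In the almost everywhere
   statements the endpoints of the interval form a null set, so the two-sided
   derivative taken there is harmless. *)

(* The line with the Lebesgue sigma-algebra, obtained by the Caratheodory
   construction; the instance carried by R itself is the Borel one. *)
Notation lebesgueType R := (caratheodory_type (@wlength R idfun)^*%mu).

Section dynamics.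
Context {R : realType} {n : nat}.
Notation vec := 'rV[R]_n.
Notation mu := (@lebesgue_measure R).
Implicit Types (F : vec -> set vec) (f : R -> vec -> vec) (phi : R -> vec).

Definition absolutely_continuous (a b : R) phi :=
  forall e : R, 0 < e -> exists2 d : R, 0 < d &
    forall (m : nat) (u v : 'I_m -> R),
      (forall i, a <= u i /\ u i <= v i /\ v i <= b) ->
      trivIset setT (fun i => `]u i, v i[%classic) ->
      \sum_(i < m) (v i - u i) < d ->
      \sum_(i < m) enorm (phi (v i) - phi (u i)) < e.

Definition trajectory F (T : R) (x0 : vec) phi :=
  [/\ absolutely_continuous 0 T phi, phi 0 = x0 &
    {ae mu, forall t, t \in `[0, T] ->
      derivable phi t 1 /\ F (phi t) (phi^`()%classic t)}].

Definition ivp_solution f (T : R) (x0 : vec) phi :=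
  [/\ absolutely_continuous 0 T phi, phi 0 = x0 &
    {ae mu, forall t, t \in `[0, T] ->
      derivable phi t 1 /\ phi^`()%classic t = f t (phi t)}].

Definition unique_ivp_solution f (T : R) (x0 : vec) phi :=
  ivp_solution f T x0 phi /\
  forall y, ivp_solution f T x0 y -> {in `[0, T], y =1 phi}.

Definition modulus (w : R -> R) :=
  [/\ {in `[0, +oo[, forall r, 0 <= w r},
      {in `[0, +oo[ &, forall r s, r <= s -> w r <= w s},
      {within `[0, +oo[%classic, continuous w} &
      w 0 = 0].

(* Measurability of t |-> f t x is Lebesgue measurability on [0, T] of all its
   coordinates. *)
Definition classC (T : R) f :=
  [/\ forall (x : vec) (i : 'I_n), measurable_fun
        (`[0, T]%classic : set (lebesgueType R))
        ((fun t => f t x 0 i) : lebesgueType R -> R),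
      forall K : set vec, compact K -> exists2 w, modulus w &
        forall t x1 x2, t \in `[0, T] -> K x1 -> K x2 ->
          enorm (f t x1 - f t x2) <= w (enorm (x1 - x2)) &
      exists c1 c2 : R, [/\ 0 < c1, 0 < c2 &
        forall t x, t \in `[0, T] -> enorm (f t x) <= c1 + c2 * enorm x]].

(* The null set of times does not depend on the point of the ball. *)
Definition classCF F (T : R) (xbar : vec) f :=
  classC T f /\
  exists2 g : R, 0 < g &
    {ae mu, forall t, t \in `[0, T] ->
      forall x, eball xbar g x -> cone (F x) (f t x)}.

Definition conditionU F :=
  forall (xbar : vec) (T : R), 0 <= T ->
  forall phi, trajectory F T xbar phi ->
  exists2 f, classCF F T xbar f & unique_ivp_solution f T xbar phi.

Definition multi_lsc F :=
  forall O : set vec, open O -> open [set x | F x `&` O !=set0].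

Definition hamiltonian F (x p : vec) : \bar R :=
  ereal_sup [set (dot v p)%:E | v in F x].

(* x is a trajectory on [0, T[, with 0 < T <= +oo, that stops only by
   escaping to infinity. *)
Definition maximal_trajectory F (x0 : vec) (T : \bar R) (x : R -> vec) :=
  [/\ (0 < T)%E,
      forall a b : R, 0 <= a -> a <= b -> (b%:E < T)%E ->
        absolutely_continuous a b x,
      x 0 = x0,
      {ae mu, forall t, 0 <= t -> (t%:E < T)%E ->
        derivable x t 1 /\ F (x t) (x^`()%classic t)} &
      T = +oo%E \/
      exists2 r : R, T = r%:E & enorm (x t) @[t --> r^'-] --> +oo].

Definition strongly_invariant F (E : set vec) :=
  forall x0, E x0 -> forall (T : \bar R) (x : R -> vec),
    maximal_trajectory F x0 T x ->
    forall t : R, 0 <= t -> (t%:E < T)%E -> E (x t).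

End dynamics.

(* Main.v *)
Require Import Defs.
From HB Require Import structures.
From mathcomp Require Import all_boot all_order all_algebra.
From mathcomp Require Import all_classical all_reals all_analysis.
From mathcomp Require Import measurable_realfun ring lra.

Set Implicit Arguments.
Unset Strict Implicit.
Unset Printing Implicit Defensive.

Import Order.TTheory GRing.Theory Num.Theory.
Import numFieldNormedType.Exports.

Local Open Scope classical_set_scope.
Local Open Scope ring_scope.

(** Sufficiency. Let [xbar] be the last point of [S] on a trajectory [phi] that leaves [S], and
    let [f] be the feedback given by (U) for [phi] restarted at [xbar]. Euler polygons for [f]
    whose slopes are frozen at a nearest point [s] of [S] instead of the current node [x]
    approach [S]: [x - s] is a proximal normal at [s], hence [<x - s, f(t, s)> <= 0], and the
    squared distance to [S] grows by at most [O(h^2)] in a step of length [h]. A limit of the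
    polygons therefore solves [y' = f(t, y)] and stays in [S] for a short time; by uniqueness it
    is [phi], a contradiction.

    Necessity. For [v] in [F(xbar)] Michael's theorem gives a continuous selection [g] of [F] with
    [g(xbar) = v]. The bounded field [g / (1 + |g|)] has a solution on [0, +oo[; running it with
    the right clock gives a maximal trajectory of [F], which stays in [S] by invariance. Its
    initial velocity is [v], so the proximal inequality at [xbar] gives [<p, v> <= 0]. *)

(** * Euclidean norm, projections and proximal normals *)

(** Many trajectories of [F] may start at one point, and polygons that stay near [S] only produce
    some solution in [S], not the given trajectory; uniqueness in (U) identifies the two. The slope
    is taken at a point of [S] because the normal inequality speaks only of such points, and values
    in the cone suffice because nonnegative multiples keep its sign. As [f] is merely measurable in
    time, an Euler step integrates [f(t, s)] over the step instead of sampling it. About [1/h] steps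
    with an error [O(h^2)] each leave [O(h)] in the squared distance. In the converse the selection
    [g] has no growth bound, so its solutions may blow up, while strong invariance speaks only of
    trajectories that are global or escape to infinity; the bounded field moves a possible blow-up
    into the clock. *)

(** [`|x|] is the sup norm. Comparing it with [enorm] up to the factor [n] is enough below, so
    that neither the Cauchy-Schwarz nor the triangle inequality for [enorm] is needed. *)
Section norms.
Context {R : realType} {n : nat}.
Implicit Types x y u v : 'rV[R]_n.

Lemma norm_coord x i : `|x 0 i| <= `|x|.
Proof.
rewrite [leRHS]mx_normrE.
exact: (le_bigmax _ (fun ij : 'I_1 * 'I_n => `|x ij.1 ij.2|) (0, i)).
Qed.

Lemma norm_leP x (r : R) : 0 <= r -> (forall i, `|x 0 i| <= r) -> `|x| <= r.
Proof.
move=> r0 xr; rewrite [leLHS]mx_normrE; apply/bigmax_leP; split => // -[i j] _.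
by rewrite ord1; exact: xr.
Qed.

Lemma dotDl u v w : dot (u + v) w = dot u w + dot v w :> R.
Proof. by rewrite -big_split; apply: eq_bigr => i _; rewrite mxE mulrDl. Qed.

Lemma dotC u v : dot u v = dot v u :> R.
Proof. by apply: eq_bigr => i _; rewrite mulrC. Qed.

Lemma dotDr u v w : dot w (u + v) = dot w u + dot w v :> R.
Proof. by rewrite dotC dotDl !(dotC w). Qed.

Lemma dotZl a u v : dot (a *: u) v = a * dot u v :> R.
Proof. by rewrite mulr_sumr; apply: eq_bigr => i _; rewrite mxE mulrA. Qed.

Lemma dotZr a u v : dot u (a *: v) = a * dot u v :> R.
Proof. by rewrite dotC dotZl dotC. Qed.

Lemma dotNl u v : dot (- u) v = - dot u v :> R.
Proof. by rewrite -scaleN1r dotZl mulN1r. Qed.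

Lemma dotNr u v : dot u (- v) = - dot u v :> R.
Proof. by rewrite dotC dotNl dotC. Qed.

Definition dotE := (dotDl, dotDr, dotNl, dotNr, dotZl, dotZr).

Lemma dot_ge0 u : 0 <= dot u u :> R.
Proof. by apply: sumr_ge0 => i _; rewrite -expr2 sqr_ge0. Qed.

Lemma enorm_sqr u : enorm u ^+ 2 = dot u u :> R.
Proof. by rewrite sqr_sqrtr// dot_ge0. Qed.

Lemma norm_le_enorm u : `|u| <= enorm u :> R.
Proof.
apply: norm_leP; first exact: sqrtr_ge0.
move=> i; rewrite -[leLHS]sqrtr_sqr ler_wsqrtr//.
rewrite [leRHS](bigD1 i)//= -expr2 lerDl.
by apply: sumr_ge0 => j _; rewrite -expr2 sqr_ge0.
Qed.

Lemma enorm_le_norm u : enorm u <= n%:R * `|u| :> R.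
Proof.
rewrite -[leRHS]ger0_norm ?mulr_ge0// -[leRHS]sqrtr_sqr ler_wsqrtr//.
apply: (@le_trans _ _ (\sum_(i < n) `|u| ^+ 2)).
  apply: ler_sum => i _; rewrite -expr2 -real_normK ?num_real//.
  by rewrite ler_pXn2r// ?nnegrE// norm_coord.
rewrite sumr_const card_ord exprMn -[leLHS]mulr_natl ler_wpM2r ?sqr_ge0//.
by rewrite -natrX ler_nat; case: (n) => // m; rewrite -mulnn leq_pmulr.
Qed.

Lemma coord_rV_continuous i : continuous (fun x : 'rV[R]_n => x 0 i).
Proof. exact: (@coord_continuous R 1 n 0 i). Qed.

Lemma dot_continuousr u : continuous (dot u : 'rV[R]_n -> R).
Proof.
apply: continuous_big => [|i _ v]; first exact: add_continuous.
by apply: (@cvgMr _ _ (nbhs v)); apply: coord_rV_continuous.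
Qed.

Lemma dot_diag_continuous : continuous (fun u => dot u u : R).
Proof.
apply: continuous_big => [|i _ v]; first exact: add_continuous.
by apply: (@cvgM _ _ (nbhs v)); apply: coord_rV_continuous.
Qed.

Lemma closed_ball_compact x (r : R) : compact [set y | `|x - y| <= r].
Proof.
have [r0|r0] := ltP 0 r; last first.
  have [r00|r00] := eqVneq r 0.
    rewrite (_ : [set _ | _] = [set x]); first exact: compact_set1.
    apply/seteqP; split => y /=; rewrite r00.
      by rewrite normr_le0 subr_eq0 => /eqP.
    by move->; rewrite subrr normr0.
  rewrite (_ : [set _ | _] = set0); first exact: compact0.
  apply/seteqP; split => y //=; rewrite leNgt => /negP; apply.
  by rewrite (lt_le_trans _ (normr_ge0 _))// lt_neqAle r00.
apply: bounded_closed_compact.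
  exists (`|x| + r); split; first exact: num_real.
  move=> M rM y /= yr; rewrite (le_trans _ (ltW rM))//.
  by rewrite -[y](subKr x) (le_trans (ler_normB _ _))// lerD.
have -> : [set y | `|x - y| <= r] = closed_ball x r by rewrite closed_ballE.
exact: closed_ball_closed.
Qed.

(** A minimum over the compact part of [S] in the sup-norm ball of radius [enorm (x - s0)] is
    global: the sup norm is below [enorm], so points outside are farther from [x] than [s0]. *)
Lemma projection_exists (S : set 'rV[R]_n) (s0 : 'rV[R]_n) x : closed S -> S s0 ->
  exists2 s, S s & forall s', S s' -> dot (x - s) (x - s) <= dot (x - s') (x - s') :> R.
Proof.
move=> cS Ss0; set B := [set y | `|x - y| <= enorm (x - s0)].
have cSB : compact (S `&` B).
  rewrite setIC; apply: compact_closedI => //; exact: closed_ball_compact.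
have SB0 : S `&` B !=set0 by exists s0; split => //; exact: norm_le_enorm.
have [s /set_mem[Ss Bs] smin] : exists2 s, s \in S `&` B &
    forall t, t \in S `&` B -> dot (x - s) (x - s) <= dot (x - t) (x - t) :> R.
  apply: (@compact_EVT_min _ R (fun t : 'rV[R]_n => dot (x - t) (x - t)) (S `&` B)) => //.
  apply: continuous_subspaceT => t.
  apply: (@continuous_comp _ _ R (fun t : 'rV[R]_n => x - t) (fun u : 'rV[R]_n => dot u u)).
    by apply: (@cvgB _ _ _ (nbhs t)) => //; exact: cvg_cst.
  exact: dot_diag_continuous.
exists s => // s' Ss'.
have [Bs'|Bs'] := pselect (B s'); first by apply: smin; apply/mem_set.
have le0 : dot (x - s) (x - s) <= dot (x - s0) (x - s0) :> R.
  by apply: smin; apply/mem_set; split => //; exact: norm_le_enorm.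
apply: le_trans le0 _; move/negP : Bs'; rewrite -ltNge => /ltW Bs'.
rewrite -!enorm_sqr ler_pXn2r ?nnegrE ?sqrtr_ge0//.
exact: le_trans Bs' (norm_le_enorm _).
Qed.

(** Expanding the squared distance from [x] to [s'] around [s] gives the proximal inequality with
    constant 1/2; 1 is a convenient larger one. *)
Lemma nearest_proximal (S : set 'rV[R]_n) s x :
  (forall s', S s' -> dot (x - s) (x - s) <= dot (x - s') (x - s') :> R) ->
  proximal_normal S s (x - s).
Proof.
move=> smin; exists 1 => // s' Ss'; rewrite mul1r enorm_sqr.
have := smin _ Ss'; have := dot_ge0 (s' - s).
rewrite !dotE (dotC s' s) (dotC s x) (dotC s' x) ; lra.
Qed.

Lemma proximal_normal_interior (S : set 'rV[R]_n) s z :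
  interior S s -> proximal_normal S s z -> z = 0.
Proof.
move=> /nbhs_ballP[e /= e0 eS] [c c0 zc].
have [->//|z0] := eqVneq z 0.
have nz : 0 < `|z| by rewrite normr_gt0.
have zz : 0 < dot z z :> R.
  rewrite -enorm_sqr exprn_gt0// (lt_le_trans nz)//; exact: norm_le_enorm.
(* The first bound keeps [s + a *: z] in the ball inside [S]. The second gives [a * c <= 1 / 2],
   whereas the proximal inequality at this point would force [1 <= a * c]. *)
pose a : R := Num.min (e / 2 / `|z|) (c^-1 / 2).
have a0 : 0 < a by rewrite lt_min !divr_gt0// invr_gt0.
have : S (s + a *: z).
  apply: eS; rewrite -ball_normE /= opprD addrA subrr sub0r normrN normrZ gtr0_norm//.
  rewrite -ltr_pdivlMr// (@le_lt_trans _ _ (e / 2 / `|z|))// ?ge_min ?lexx//.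
  by rewrite ltr_pM2r ?invr_gt0//; lra.
move=> /zc; rewrite addrC addKr enorm_sqr !dotE.
have : a * c <= 1 / 2.
  rewrite (@le_trans _ _ (c^-1 / 2 * c))//.
    by rewrite ler_wpM2r ?(ltW c0)// /a ge_min lexx orbT.
  by rewrite mulrAC mulVf ?gt_eqF// mul1r.
move=> ac; rewrite mulrCA [c * (a * _)]mulrA (mulrC c) ler_pM2l// => le_zz; exfalso; nra.
Qed.

End norms.

(** * Michael's selection theorem *)

Section selection.
Context {R : realType} {n : nat}.
Notation vec := 'rV[R]_n.

Lemma vec_dense_seq : exists q : nat -> vec,
  forall x (e : R), 0 < e -> exists k, `|x - q k| < e.
Proof.
exists (fun k => map_mx ratr (odflt (0 : 'rV[rat]_n) (unpickle k))) => x e e0.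
have /choice[r rP] : forall i : 'I_n, exists r : rat, `|x 0 i - ratr r| <= e / 2.
  move=> i; have /rat_in_itvoo[r] : x 0 i - e / 2 < x 0 i + e / 2 by lra.
  rewrite in_itv /= => /andP[r1 r2]; exists r.
  by rewrite ler_norml; apply/andP; split; lra.
exists (pickle (\row_i r i)); rewrite pickleK /=.
apply: (@le_lt_trans _ _ (e / 2)); last by lra.
apply: norm_leP => [|i]; first by lra.
by rewrite !mxE.
Qed.

Lemma convex_comb (A : set vec) (x y : vec) (t : R) : convex_set A ->
  A x -> A y -> 0 <= t -> t <= 1 -> A (t *: x + (1 - t) *: y).
Proof.
move=> cA Ax Ay t0 t1.
by have /set_mem := cA x y (Itv01 t0 t1) (mem_set Ax) (mem_set Ay).
Qed.

(** Membership of [p k] is asked only for positive weights, because the selection below uses an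
    arbitrary default for [p k] at the other indices. *)
Lemma convex_wavg (A : set vec) (w : nat -> R) (p : nat -> vec) N :
  convex_set A -> (forall k, 0 <= w k) -> (forall k, 0 < w k -> A (p k)) ->
  0 < \sum_(k < N) w k ->
  A ((\sum_(k < N) w k)^-1 *: \sum_(k < N) w k *: p k).
Proof.
move=> cA w0 wA; elim: N => [|N IH]; first by rewrite big_ord0 ltxx.
rewrite !big_ord_recr /=.
set W := \sum_(i < N) w i in IH *; set P := \sum_(i < N) _ in IH *.
have W0 : 0 <= W by apply: sumr_ge0.
have [WN0|WN0] := ltP 0 (w N); last first.
  have -> : w N = 0 by apply/eqP; rewrite eq_le WN0 w0.
  by rewrite addr0 scale0r addr0.
move=> S0; have [W1|W1] := ltP 0 W; last first.
  have W00 : W = 0 by apply/eqP; rewrite eq_le W1 W0.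
  have -> : P = 0.
    apply: big1 => i _; move/eqP : W00; rewrite psumr_eq0 => [|//].
    by move=> /allP/(_ i (mem_index_enum _))/eqP ->; rewrite scale0r.
  rewrite W00 !add0r scalerA mulVf ?gt_eqF// scale1r; exact: wA.
have -> : (W + w N)^-1 *: (P + w N *: p N) =
    (W / (W + w N)) *: (W^-1 *: P) + (1 - W / (W + w N)) *: p N.
  rewrite scalerDr !scalerA; congr (_ + _); congr (_ *: _).
    by field; rewrite !gt_eqF.
  by field; rewrite !gt_eqF.
apply: convex_comb => //.
- exact: IH.
- exact: wA.
- by rewrite divr_ge0// ltW.
- by rewrite ler_pdivrMr// mul1r lerDl.
Qed.

(** The distance to the complement of [U], capped at 1 so that it is finite also for [U = setT]. *)
Definition depth (U : set vec) (x : vec) : R :=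
  sup [set r | 0 <= r <= 1 /\ forall y : vec, `|y - x| < r -> U y].

Lemma depth_sup (U : set vec) (x : vec) :
  has_sup [set r : R | 0 <= r <= 1 /\ forall y : vec, `|y - x| < r -> U y].
Proof.
split; last by exists 1 => r /= [/andP[_ ->]].
by exists 0; split; [rewrite lexx ler01|move=> y; rewrite ltNge normr_ge0].
Qed.

Lemma depth_ge0 U x : 0 <= depth U x.
Proof.
apply: (sup_upper_bound (depth_sup U x)).
by split; [rewrite lexx ler01|move=> y; rewrite ltNge normr_ge0].
Qed.

Lemma depth_le1 U x : depth U x <= 1.
Proof.
apply: sup_le_ub; last by move=> r /= [/andP[_ ->]].
by have [] := depth_sup U x.
Qed.

Lemma depth_gt0 (U : set vec) x : open U -> U x -> 0 < depth U x.
Proof.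
move=> oU Ux; have /nbhs_ballP[e /= e0 eU] := open_nbhs_nbhs (conj oU Ux).
apply: (@lt_le_trans _ _ (Num.min e 1)); first by rewrite lt_min e0 ltr01.
apply: (sup_upper_bound (depth_sup U x)); split.
  by rewrite ge_min lexx orbT andbT le_min (ltW e0) ler01.
move=> y yx; apply: eU; rewrite -ball_normE /= distrC.
by apply: lt_le_trans yx _; rewrite ge_min lexx.
Qed.

Lemma depth_gt0_mem (U : set vec) x : 0 < depth U x -> U x.
Proof.
move=> /(sup_adherent)/(_ (depth_sup U x))[r [_ rU]].
by rewrite subrr => r0; apply: rU; rewrite subrr normr0.
Qed.

Lemma depth_lip (U : set vec) (x y : vec) : depth U x - `|x - y| <= depth U y.
Proof.
rewrite lerBlDr; apply: sup_le_ub; first by have [] := depth_sup U x.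
move=> r /= [/andP[r0 r1] rU]; rewrite -lerBlDr.
have [rxy|rxy] := leP (r - `|x - y|) 0; first exact: le_trans rxy (depth_ge0 _ _).
apply: (sup_upper_bound (depth_sup U y)); split.
  rewrite (ltW rxy) /=; rewrite lerBlDr (le_trans r1)// lerDl//.
move=> z zy; apply: rU; rewrite -(subrKA y) (le_lt_trans (ler_normD _ _))//.
by rewrite -ltrBrDr (distrC y).
Qed.

Lemma lip_continuous (g : vec -> R) :
  (forall x y, g x - `|x - y| <= g y) -> continuous g.
Proof.
move=> gl x; apply/(@cvgrPdist_lt _ _ _ (nbhs x)) => e e0.
apply/nbhs_ballP; exists e => //= y; rewrite -ball_normE /= => xy.
have := gl x y; have := gl y x; rewrite (distrC y) => h1 h2.
by rewrite ltr_norml; apply/andP; split; lra.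
Qed.


Section approximate_selection.
Variables (Phi : vec -> set vec) (e : R) (q : nat -> vec).
Hypothesis Phi_lsc : multi_lsc Phi.
Hypothesis Phi_convex : forall x, convex_set (Phi x).
Hypothesis Phi0 : forall x, Phi x !=set0.
Hypothesis e0 : 0 < e.
Hypothesis q_dense : forall x (d : R), 0 < d -> exists k, `|x - q k| < d.

(** Lower semicontinuity makes these sets open, and density of [q] makes them cover the space. *)
Let U k : set vec := [set x | Phi x `&` ball (q k) e !=set0].
Let rho k x := depth (U k) x.
(* Where [rho j > c > 0], every [lam k] with [k > j] and [k >= 1 / c] vanishes: the weights are
   locally finite although the cover [U] is not. *)
Let lam k x : R := Num.max 0 (rho k x - k%:R * \sum_(j < k) rho j x).

Let U_open k : open (U k).
Proof. by apply: Phi_lsc; exact: ball_open. Qed.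

Let rho_continuous k : continuous (rho k).
Proof. by apply: lip_continuous; exact: depth_lip. Qed.

Let lam_continuous k : continuous (lam k).
Proof.
move=> x; apply: (@continuous_max _ _ (fun=> 0) _ x); first exact: cst_continuous.
apply: (@cvgB _ _ _ (nbhs x)); first exact: rho_continuous.
apply: (@cvgMr _ _ (nbhs x)).
apply: continuous_big => [|i _]; first exact: add_continuous.
exact: rho_continuous.
Qed.

Let lam_ge0 k x : 0 <= lam k x.
Proof. by rewrite /lam le_max lexx. Qed.

Let lam_gt0 k x : 0 < lam k x -> U k x.
Proof.
rewrite /lam lt_max ltxx /= => lam0; apply: depth_gt0_mem.
rewrite (lt_le_trans lam0)// gerBl mulr_ge0// sumr_ge0// => i _.
exact: depth_ge0.
Qed.

Let rho_pos x : exists k, 0 < rho k x.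
Proof.
have [v Pv] := Phi0 x; have [k vk] := q_dense v e0.
exists k; apply: depth_gt0 => //; exists v; split => //.
by rewrite -ball_normE /= distrC.
Qed.

(** At the least index with positive [rho], the subtracted sum vanishes. *)
Let lam_pos x : exists k, 0 < lam k x.
Proof.
have /ex_minnP[k rk kmin] := rho_pos x; exists k.
rewrite /lam big1 ?mulr0 ?subr0; first by rewrite lt_max rk orbT.
move=> j _; apply/eqP; rewrite eq_le depth_ge0 andbT leNgt.
by apply/negP => /kmin; rewrite leqNgt ltn_ord.
Qed.

Let lam_locally_finite x : exists N, exists2 d : R, 0 < d &
  forall y k, `|x - y| < d -> (N <= k)%N -> lam k y = 0.
Proof.
(* Since [rho k0] is 1-Lipschitz with value [2 * c] at [x], it is at least [c] within distance [c]
   of [x]; depths never exceed 1, so [k >= 1 / c] suffices. *)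
have [k0 rk] := rho_pos x; set c := rho k0 x / 2.
have c0 : 0 < c by rewrite divr_gt0.
exists (maxn k0.+1 (Num.truncn c^-1).+1), c => // y k xy.
rewrite geq_max => /andP[k0k ck]; apply/max_idPl.
rewrite subr_le0 (le_trans (depth_le1 _ _))//.
have ry : c <= \sum_(j < k) rho j y.
  rewrite (bigD1 (Ordinal k0k))//= -[leLHS]addr0 lerD//; last first.
    by apply: sumr_ge0 => j _; exact: depth_ge0.
  have := depth_lip (U k0) x y; rewrite -/(rho _ _) => h.
  by apply: le_trans h; rewrite /c in xy *; lra.
have ck' : c^-1 <= k%:R.
  rewrite (le_trans (ltW (truncnS_gt _)))// ler_nat//.
by rewrite -[leLHS](@mulVf _ c) ?gt_eqF// ler_pM// ?invr_ge0 ltW.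
Qed.

Lemma approx_selection_aux : exists2 f : vec -> vec, continuous f &
  forall x, exists2 v, Phi x v & `|f x - v| <= e.
Proof.
have /choice[N NP] := lam_locally_finite.
pose W M x := \sum_(k < M) lam k x.
pose P M x := \sum_(k < M) lam k x *: q k.
have W_continuous M : continuous (W M).
  by apply: continuous_big => [|i _]; [exact: add_continuous|exact: lam_continuous].
have P_continuous M : continuous (P M).
  apply: continuous_big => [|i _ x]; first exact: add_continuous.
  by apply: (@cvgZr_tmp _ _ _ (nbhs x)); exact: lam_continuous.
have stable (V : zmodType) (g : nat -> V) M M' : (M <= M')%N ->
    (forall k, (M <= k)%N -> g k = 0) -> \sum_(k < M) g k = \sum_(k < M') g k.
  move=> MM' g0; rewrite -!(big_mkord xpredT) [RHS](big_cat_nat _ MM')//=.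
  rewrite [X in _ + X]big_nat_cond [X in _ + X]big1 ?addr0// => i /andP[/andP[Mi _] _].
  exact: g0.
(* The truncation index [N y] may jump with [y]. Near [x] the terms beyond [N x] vanish as well, so
   there the selection is a quotient of sums with the fixed number [N x] of terms, which is
   continuous. *)
have W_stable x y d : 0 < d -> (forall z k, `|x - z| < d -> (N x <= k)%N -> lam k z = 0) ->
    `|x - y| < d -> W (N y) y = W (N x) y /\ P (N y) y = P (N x) y.
  move=> d0 xd xy; have [d' d'0 yd] := NP y.
  have l0 k : (N y <= k)%N -> lam k y = 0 by apply: yd; rewrite subrr normr0.
  have l0' k : (N x <= k)%N -> lam k y = 0 by apply: xd.
  have common (V : zmodType) (g : nat -> V) : (forall k, lam k y = 0 -> g k = 0) ->
      \sum_(k < N y) g k = \sum_(k < N x) g k.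
    move=> g0; rewrite (stable _ g (N y) (maxn (N x) (N y))) ?leq_maxr//; last first.
      by move=> k /l0 /g0.
    by rewrite -(stable _ g (N x)) ?leq_maxl// => k /l0' /g0.
  split; first exact: (common _ (fun k => lam k y)).
  by apply: (common _ (fun k => lam k y *: q k)) => k ->; rewrite scale0r.
have W0 x : 0 < W (N x) x.
  have [k lk] := lam_pos x; have [d d0 xd] := NP x.
  have kN : (k < N x)%N.
    rewrite ltnNge; apply/negP => /(xd x) lk0.
    by move: lk; rewrite lk0 ?ltxx// subrr normr0.
  rewrite /W (bigD1 (Ordinal kN))//= ltr_pwDl//.
  by apply: sumr_ge0.
exists (fun x => (W (N x) x)^-1 *: P (N x) x).
  move=> x; have [d d0 xd] := NP x.
  have : (fun y => (W (N x) y)^-1 *: P (N x) y) @ x --> (W (N x) x)^-1 *: P (N x) x.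
    apply: (@cvgZ _ _ _ (nbhs x)).
      by apply: (@cvgV _ _ (nbhs x)); [rewrite gt_eqF|exact: W_continuous].
    exact: P_continuous.
  apply: cvg_trans; apply: (@near_eq_cvg _ _ (nbhs x)).
  apply/nbhs_ballP; exists d => //= y; rewrite -ball_normE /= => xy.
  by have [-> ->] := W_stable x y d d0 xd xy.
(* Replacing each [q k] of positive weight by a value [p k] of [Phi x] closer than [e] turns the
   average into a point of the convex set [Phi x] and moves it by at most [e]. *)
move=> x; pose p k := if pselect (U k x) is left h then sval (cid h) else 0.
have pP k : U k x -> Phi x (p k) /\ `|q k - p k| < e.
  rewrite /p; case: pselect => // h _; case: (cid h) => v /= [Pv].
  by rewrite -ball_normE.
exists ((W (N x) x)^-1 *: \sum_(k < N x) lam k x *: p k).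
  by apply: (@convex_wavg _ (fun k => lam k x) p) => // [k /lam_gt0 /pP[]|]//; exact: W0.
rewrite -scalerBr -sumrB normrZ gtr0_norm ?invr_gt0// mulrC ler_pdivrMr//.
apply: le_trans (ler_norm_sum _ _ _) _; rewrite /W mulr_sumr.
apply: ler_sum => k _; rewrite -scalerBr normrZ ger0_norm// mulrC.
have [lk|lk] := ltP 0 (lam k x).
  by rewrite ler_wpM2r// ltW//; have [] := pP _ (lam_gt0 lk).
have -> : lam k x = 0 by apply/eqP; rewrite eq_le lk lam_ge0.
by rewrite !mulr0.
Qed.

End approximate_selection.

Lemma approx_selection (Phi : vec -> set vec) (e : R) : multi_lsc Phi ->
  (forall x, convex_set (Phi x)) -> (forall x, Phi x !=set0) -> 0 < e ->
  exists2 f : vec -> vec, continuous f &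
    forall x, exists2 v, Phi x v & `|f x - v| < e.
Proof.
move=> Plsc Pconv P0 e0; have [q qd] := vec_dense_seq.
have e20 : 0 < e / 2 by lra.
have [f cf fP] := approx_selection_aux Plsc Pconv P0 e20 qd.
by exists f => // x; have [v Pv fv] := fP x; exists v => //; lra.
Qed.

(** The strict inequality is essential: the slack left by a value [v] is positive, and half of it is
    spent on the variation of [f], half on the choice of a nearby value. *)
Lemma lsc_near_selection (Phi : vec -> set vec) (f : vec -> vec) (e : R) :
  multi_lsc Phi -> continuous f ->
  multi_lsc (fun x => Phi x `&` [set v | `|f x - v| < e]).
Proof.
move=> Plsc cf O oO; rewrite openE => x [v [[Pv /= fv] Ov]].
set d := (e - `|f x - v|) / 2.
have d0 : 0 < d by rewrite divr_gt0// subr_gt0.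
have oO' : open (O `&` ball v d) by apply: openI => //; exact: ball_open.
have Px : [set x | Phi x `&` (O `&` ball v d) !=set0] x.
  by exists v; split => //; split => //; exact: ballxx.
have := open_nbhs_nbhs (conj (Plsc _ oO') Px).
have fd : \forall y \near x, `|f x - f y| < d.
  by move: (cf x) => /(@cvgrPdist_lt _ _ _ (nbhs x))/(_ d d0).
apply: filterS2 fd => y fxy /= [w [Pw [Ow]]]; rewrite -ball_normE /= => vw.
exists w; split => //; split => //=.
have -> : f y - w = (f x - v) + ((v - w) - (f x - f y)).
  by apply/rowP => i; rewrite !mxE; ring.
rewrite (le_lt_trans (ler_normD _ _))//.
have := ler_normB (v - w) (f x - f y); rewrite /d in fxy vw; lra.
Qed.

(** * From approximate to exact selections *)

Section michael.
Variable F : vec -> set vec.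
Hypothesis F_lsc : multi_lsc F.
Hypothesis F_convex : forall x, convex_set (F x).
Hypothesis F_closed : forall x, closed (F x).
Hypothesis F0 : forall x, F x !=set0.

Let eps k : R := 2^-1 ^+ k.

Let eps_gt0 k : 0 < eps k.
Proof. by rewrite /eps exprn_gt0// invr_gt0. Qed.

Let near_selection (k : nat) (f : vec -> vec) := continuous f /\
  forall x, exists2 v, F x v & `|f x - v| < eps k.

(** The approximate selection is taken from the values of [F] closer than [eps k] to [f]. There are
    such values by assumption, and they keep the new selection close to the old one. *)
Let refine_selection k f : near_selection k f -> exists g : vec -> vec,
  near_selection k.+1 g /\ forall x, `|f x - g x| <= eps k + eps k.+1.
Proof.
move=> [cf fF].
have [||g cg gP] := approx_selection (lsc_near_selection (e := eps k) F_lsc cf) _ _ (eps_gt0 k.+1).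
- move=> x u v t /set_mem[Fu /= fu] /set_mem[Fv /= fv]; apply/mem_set; split.
    by have /set_mem := F_convex t (mem_set Fu) (mem_set Fv).
  have t0 : 0 <= t%:num by [].
  have t1 : t%:num <= 1 by [].
  rewrite /= (_ : f x - _ = t%:num *: (f x - u) + (1 - t%:num) *: (f x - v)); last first.
    rewrite [conv t u v](_ : _ = t%:num *: (u : vec) + (1 - t%:num) *: (v : vec))//.
    by apply/rowP => i; rewrite !mxE; ring.
  rewrite (le_lt_trans (ler_normD _ _))// !normrZ (ger0_norm t0).
  rewrite (@ger0_norm _ (1 - t%:num)) ?subr_ge0//.
  have [->|tn0] := eqVneq (t%:num) 0; first by rewrite mul0r subr0 mul1r add0r.
  have : 0 < t%:num by rewrite lt_neqAle eq_sym tn0.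
  nra.
- by move=> x; have [v Fv fv] := fF x; exists v.
exists g; split; first by split => // x; have [v [Fv _] gv] := gP x; exists v.
move=> x; have [v [Fv /= fv] gv] := gP x.
rewrite -(subrKA v) (le_trans (ler_normD _ _))// lerD ?(ltW fv)//.
by rewrite distrC ltW.
Qed.

Lemma michael_selection : exists2 g : vec -> vec, continuous g &
  forall x, F x (g x).
Proof.
have [f0 cf0 f0F] := approx_selection F_lsc F_convex F0 ltr01.
(* The choice ranges over all functions, with [f] itself as a dummy successor when it is not a near
   selection; this permits a plain recursion. *)
have /choice[step stepP] : forall kf : nat * (vec -> vec), exists g,
    near_selection kf.1 kf.2 -> near_selection kf.1.+1 g /\
      forall x, `|kf.2 x - g x| <= eps kf.1 + eps kf.1.+1.
  move=> [k f]; have [/refine_selection[g gP]|nf] := pselect (near_selection k f).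
    by exists g.
  by exists f.
pose fs := fix fs k := if k is k'.+1 then step (k', fs k') else f0.
have fsP k : near_selection k (fs k).
  elim: k => [|k IH] /=; first by split => // x; rewrite /eps expr0.
  by have [] := stepP (k, fs k) IH.
have fs_step k x : `|fs k x - fs k.+1 x| <= 2 * eps k.
  have [_ /(_ x)] := stepP (k, fs k) (fsP k) => /= h; apply: le_trans h _.
  by rewrite /eps exprS; have := eps_gt0 k; rewrite /eps; lra.
(* The right-hand side is the geometric sum of the bounds [2 * eps j] for [j] from [k] to
   [k + m - 1]. *)
have fs_dist k m x : `|fs k x - fs (k + m)%N x| <= 4 * (eps k - eps (k + m)).
  elim: m => [|m IH]; first by rewrite addn0 !subrr normr0 mulr0.
  rewrite addnS -(subrKA (fs (k + m)%N x)) (le_trans (ler_normD _ _))//.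
  have := fs_step (k + m)%N x.
  rewrite (_ : eps (k + m).+1 = 2^-1 * eps (k + m)) ?/eps ?exprS//.
  rewrite /eps in IH; lra.
have fs_le k m x : (k <= m)%N -> `|fs k x - fs m x| <= 4 * eps k.
  move=> km; have := fs_dist k (m - k)%N x; rewrite subnKC// => h.
  by apply: le_trans h _; have := eps_gt0 m; lra.
have eps_cvg : eps k @[k --> \oo] --> (0 : R).
  by apply: cvg_expr; rewrite ger0_norm ?invr_ge0//; lra.
have eps_small d : 0 < d -> exists k, 4 * eps k < d.
  move=> d0; have d40 : 0 < d / 4 by lra.
  move/cvgrPdist_lt : eps_cvg => /(_ _ d40)[k _ /(_ k (leqnn _))] /=.
  by rewrite sub0r normrN ger0_norm ?(ltW (eps_gt0 _))// => h; exists k; lra.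
have fs_cvg x : cvgn (fun k => fs k x).
  apply/cauchy_cvgP/cauchy_exP => d d0; have [k kd] := eps_small d d0.
  exists (fs k x); exists k => // m /= km; rewrite -ball_normE /=.
  exact: le_lt_trans (fs_le k m x km) kd.
pose g : vec -> vec := fun x => limn (fun k => fs k x).
have g_dist k x : `|fs k x - g x| <= 4 * eps k.
  apply/ler_addgt0Pr => d d0.
  move: (fs_cvg x) => /(@cvgrPdist_lt _ _ _ \oo)/(_ d d0)[m _ mP].
  rewrite -(subrKA (fs (maxn k m) x)) (le_trans (ler_normD _ _))// lerD//.
    by apply: fs_le; exact: leq_maxl.
  by rewrite distrC ltW//; apply: mP => /=; exact: leq_maxr.
exists g.
  move=> x; apply/(@cvgrPdist_lt _ _ _ (nbhs x)) => d d0.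
  have [k kd] : exists k, 4 * eps k < d / 3 by apply: eps_small; lra.
  have [cfk _] := fsP k.
  have d30 : 0 < d / 3 by lra.
  have := cfk x => /(@cvgrPdist_lt _ _ _ (nbhs x))/(_ _ d30).
  apply: filterS => y xy.
  have -> : g x - g y = (fs k y - g y) + ((fs k x - fs k y) - (fs k x - g x)).
    by apply/rowP => i; rewrite !mxE; ring.
  rewrite (le_lt_trans (ler_normD _ _))//.
  have := ler_normB (fs k x - fs k y) (fs k x - g x).
  have := g_dist k x; have := g_dist k y; lra.
move=> x; rewrite [F x](closure_id (F x)).1// => B /nbhs_ballP[d /= d0 dB].
have [k kd] : exists k, 4 * eps k < d / 2 by apply: eps_small; lra.
have [_ /(_ x)[v Fv fv]] := fsP k.
exists v; split => //; apply: dB; rewrite -ball_normE /=.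
rewrite -(subrKA (fs k x)) (le_lt_trans (ler_normD _ _))// distrC.
have := g_dist k x; have := eps_gt0 k; lra.
Qed.

End michael.

End selection.

(** * Vector-valued integrals and Lebesgue null sets *)

Section derivatives.
Context {R : realType}.

(** Existence and value of a derivative become a single limit, so that coordinates, shifts and time
    changes can be treated on difference quotients. *)
Lemma derive1_cvgP (V : normedModType R) (f : R -> V) (t : R) (l : V) :
  h^-1 *: (f (h + t) - f t) @[h --> 0^'] --> l <->
  derivable f t 1 /\ f^`()%classic t = l.
Proof.
have E : (fun h : R => h^-1 *: (f (h *: 1 + t) - f t)) =
         (fun h => h^-1 *: (f (h + t) - f t)).
  by apply/funext => h; rewrite [_%:A]mulr1.
split => [fl|[]].
  split; last by rewrite derive1E /derive E; apply: cvg_lim fl; exact: norm_hausdorff.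
  by rewrite /derivable E; apply/cvg_ex; exists l.
by rewrite derive1E /derivable /derive E => + <-.
Qed.

Lemma cvg_coord (n : nat) (T : Type) (F : set_system T) (FF : Filter F)
    (g : T -> 'rV[R]_n) (l : 'rV[R]_n) :
  (forall i, g t 0 i @[t --> F] --> l 0 i) -> g t @[t --> F] --> l.
Proof.
move=> gl; apply/cvgrPdist_le => e e0.
have : \forall t \near F, forall i, `|l 0 i - g t 0 i| <= e.
  apply: filter_forall => i.
  by move: (gl i) => /cvgrPdist_le/(_ e e0).
apply: filterS => t tP; apply: norm_leP; first exact: ltW.
by move=> i; rewrite !mxE.
Qed.

End derivatives.

Section integrals.
Context {R : realType}.
Notation mu := (@lebesgue_measure R).

(** The class of all integrands below: it is stable under linear combinations, and it secures
    integrability on every compact interval as well as the differentiation theorems. *)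
Definition loc_bounded_measurable (u : R -> R) :=
  measurable_fun setT u /\
  forall b : R, exists M : R, forall t, `|t| <= b -> `|u t| <= M.

Lemma lbm_integrable u a b : loc_bounded_measurable u ->
  mu.-integrable `[a, b] (EFin \o u).
Proof.
move=> [mu_u bu]; apply: measurable_bounded_integrable => //.
- by rewrite /= lebesgue_measure_itv /=; case: ifP => _; rewrite ltry.
- exact: measurable_funS mu_u.
- have [M MP] := bu (Num.max `|a| `|b|).
  exists M; split; first exact: num_real.
  move=> M' MM' t /=; rewrite in_itv /= => /andP[at_ tb].
  rewrite (le_trans _ (ltW MM'))//; apply: MP.
  have h1 := ler_norm b; have h2 := lerNnormlW (lexx `|a|).
  rewrite le_max; have [t0|t0] := lerP 0 t.
    by apply/orP; right; rewrite ger0_norm//; exact: le_trans tb h1.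
  by apply/orP; left; rewrite ltr0_norm//; lra.
Qed.

Lemma Rintegral_split u (a b c : R) : loc_bounded_measurable u -> a <= b -> b <= c ->
  \int[mu]_(t in `[a, c]) u t =
  \int[mu]_(t in `[a, b]) u t + \int[mu]_(t in `[b, c]) u t.
Proof.
move=> lu ab bc.
have iu x y := @lbm_integrable u x y lu.
have := @Rintegral_itvB R u (BLeft a) (BRight c) b (iu a c).
rewrite !bnd_simp => /(_ ab bc) E.
rewrite -[LHS](subrK (\int[mu]_(t in `[a, b]) u t)) E addrC; congr (_ + _).
apply: Rintegral_itv_obnd_cbnd.
apply: integrableS (iu b c) => //; exact: subset_itv_oc_cc.
Qed.

Lemma Rintegral_le_bound u (a b e : R) : loc_bounded_measurable u -> a <= b ->
  (forall t, a <= t <= b -> u t <= e) ->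
  \int[mu]_(t in `[a, b]) u t <= (b - a) * e.
Proof.
move=> lu ab ue.
have -> : (b - a) * e = \int[mu]_(t in `[a, b]) cst e t.
  rewrite Rintegral_cst// mulrC; congr (_ * _).
  by rewrite /= lebesgue_measure_itv /= lte_fin; case: ltgtP ab => //= -> _; rewrite subrr.
apply: le_Rintegral => //; first exact: lbm_integrable.
- apply: lbm_integrable; split; first exact: measurable_cst.
  by move=> c; exists `|e|.
Qed.

Lemma lbmN u : loc_bounded_measurable u -> loc_bounded_measurable (\- u).
Proof.
move=> [mu_u bu]; split; first exact: measurableT_comp.
by move=> b; have [M MP] := bu b; exists M => t /MP; rewrite normrN.
Qed.

Lemma lbmD u v : loc_bounded_measurable u -> loc_bounded_measurable v ->
  loc_bounded_measurable (u \+ v).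
Proof.
move=> [mu_u bu] [mv bv]; split; first exact: measurable_funD.
move=> b; have [M MP] := bu b; have [M' MP'] := bv b.
exists (M + M') => t tb; rewrite (le_trans (ler_normD _ _))// lerD//.
  exact: MP.
exact: MP'.
Qed.

Lemma lbmZ k u : loc_bounded_measurable u -> loc_bounded_measurable (fun t => k * u t).
Proof.
move=> [mu_u bu]; split; first exact: measurable_funM.
move=> b; have [M MP] := bu b; exists (`|k| * M) => t /MP tM.
by rewrite normrM ler_wpM2l.
Qed.

Lemma lbm0 : loc_bounded_measurable (fun=> 0).
Proof. by split; [exact: measurable_cst|move=> b; exists 0 => t _; rewrite normr0]. Qed.

Lemma Rintegral_dist u v (a b e : R) : loc_bounded_measurable u ->
  loc_bounded_measurable v -> a <= b ->
  (forall t, a <= t <= b -> `|u t - v t| <= e) ->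
  `|\int[mu]_(t in `[a, b]) u t - \int[mu]_(t in `[a, b]) v t| <= (b - a) * e.
Proof.
move=> lu lv ab uve.
have iu := lbm_integrable a b lu; have iv := lbm_integrable a b lv.
rewrite ler_norml; apply/andP; split.
  rewrite lerNl opprB -RintegralB//.
  apply: (@Rintegral_le_bound (v \- u)) => //; first exact/lbmD/lbmN.
  by move=> t /uve; rewrite ler_norml /= => /andP[h _]; lra.
rewrite -RintegralB//.
apply: (@Rintegral_le_bound (u \- v)) => //; first exact/lbmD/lbmN.
by move=> t /uve; rewrite ler_norml /= => /andP[_ h]; lra.
Qed.

Lemma lbm_locally_integrable u : loc_bounded_measurable u ->
  locally_integrable [set: R] u.
Proof.
move=> [mu_u bu]; split => //; first exact: openT.
move=> K _ cK.
have [M [_ MP]] := compact_bounded cK.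
have [N NP] := bu (M + 1).
have : mu.-integrable K (EFin \o u).
  apply: measurable_bounded_integrable => //.
  - exact: compact_measurable.
  - exact: compact_finite_measure.
  - exact: measurable_funS mu_u.
  - exists N; split; first exact: num_real.
    move=> N' NN' t Kt /=; rewrite (le_trans _ (ltW NN'))//; apply: NP.
    by apply: MP Kt; rewrite ltrDl.
by move=> /integrableP[_].
Qed.

Lemma ae_derive_integral u : loc_bounded_measurable u ->
  {ae mu, forall t, 0 < t ->
    h^-1 *: (\int[mu]_(s in `[0, h + t]) u s - \int[mu]_(s in `[0, t]) u s)
      @[h --> 0^'] --> u t}.
Proof.
move=> lu; have := @FTC1 R u (BLeft 0) (fun y => lbm_integrable 0 y lu)
  (lbm_locally_integrable lu).
apply: (@filterS _ _ (ae_filter_ringOfSetsType mu)) => t tP t0.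
apply/(derive1_cvgP (fun x => \int[mu]_(s in `[0, x]) u s)).
by apply: tP; rewrite lte_fin.
Qed.

Lemma continuous_derive_integral u t : loc_bounded_measurable u ->
  0 < t -> {for t, continuous u} ->
  h^-1 *: (\int[mu]_(s in `[0, h + t]) u s - \int[mu]_(s in `[0, t]) u s)
      @[h --> 0^'] --> u t.
Proof.
move=> lu t0 cu; apply/(derive1_cvgP (fun x => \int[mu]_(s in `[0, x]) u s)).
apply: (@continuous_FTC1 R u (BLeft 0) t (t + 1)) => //.
- by rewrite ltrDl.
- exact: lbm_integrable.
Qed.

End integrals.

Section vector_integrals.
Context {R : realType} {n : nat}.
Notation mu := (@lebesgue_measure R).
Notation vec := 'rV[R]_n.
Implicit Types u v : R -> vec.

Definition vec_lbm u := forall i, loc_bounded_measurable (fun t => u t 0 i).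

Definition vint u (a b : R) : vec := \row_i (\int[mu]_(t in `[a, b]) u t 0 i).

Lemma vint_split u (a b c : R) : vec_lbm u -> a <= b -> b <= c ->
  vint u a c = vint u a b + vint u b c.
Proof. by move=> lu ab bc; apply/rowP => i; rewrite !mxE; exact: Rintegral_split. Qed.

Lemma vint_dist u v (a b e : R) : vec_lbm u -> vec_lbm v -> a <= b ->
  (forall t, a <= t <= b -> `|u t - v t| <= e) ->
  `|vint u a b - vint v a b| <= (b - a) * e.
Proof.
move=> lu lv ab uve; apply: norm_leP => [|i].
  by rewrite mulr_ge0 ?subr_ge0// (le_trans _ (uve a _))// lexx ab.
rewrite !mxE; apply: Rintegral_dist => // t /uve; apply: le_trans.
by have := norm_coord (u t - v t) i; rewrite !mxE.
Qed.

Lemma vec_lbm0 : vec_lbm (fun=> 0).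
Proof.
move=> i; rewrite (_ : (fun=> _) = (fun=> 0)); first exact: lbm0.
by apply/funext => t; rewrite mxE.
Qed.

Lemma vint_norm u (a b e : R) : vec_lbm u -> a <= b ->
  (forall t, a <= t <= b -> `|u t| <= e) -> `|vint u a b| <= (b - a) * e.
Proof.
move=> lu ab ue; have -> : vint u a b = vint u a b - vint (fun=> 0) a b.
  apply/rowP => i; rewrite !mxE.
  by rewrite Rintegral_cst// mul0r subr0.
by apply: vint_dist => // [|t]; [exact: vec_lbm0|rewrite subr0; exact: ue].
Qed.

Lemma dot_vint_le (z : vec) u (a b e : R) : vec_lbm u -> a <= b ->
  (forall t, a <= t <= b -> dot z (u t) <= e) -> dot z (vint u a b) <= (b - a) * e.
Proof.
move=> lu ab zu.
(* The sum over all coordinates is generalised to a list of indices, so that linearity of the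
   integral is applied one term at a time. *)
have sum_int (r : seq 'I_n) :
    loc_bounded_measurable (fun t => \sum_(i <- r) z 0 i * u t 0 i) /\
    \int[mu]_(t in `[a, b]) (\sum_(i <- r) z 0 i * u t 0 i) =
    \sum_(i <- r) z 0 i * vint u a b 0 i.
  elim: r => [|j r [IH1 IH2]].
    rewrite big_nil (_ : (fun _ => _) = fun=> 0); last first.
      by apply/funext => t; rewrite big_nil.
    by rewrite Rintegral_cst// mul0r; split => //; exact: lbm0.
  have jl := lbmZ (z 0 j) (lu j).
  rewrite (_ : (fun _ => _) = (fun t => z 0 j * u t 0 j) \+
      (fun t => \sum_(i <- r) z 0 i * u t 0 i)); last first.
    by apply/funext => t; rewrite big_cons.
  split; first exact: lbmD.
  rewrite big_cons -IH2 RintegralD//; [|exact: lbm_integrable..].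
  by rewrite RintegralZl//; [rewrite mxE|exact: lbm_integrable].
have [sl si] := sum_int (index_enum 'I_n).
rewrite /dot -si.
by apply: Rintegral_le_bound => // t tab; exact: zu.
Qed.

Lemma ae_derive_vint u (x0 : vec) : vec_lbm u ->
  {ae mu, forall t, 0 < t -> derivable (fun t => x0 + vint u 0 t) t 1 /\
    (fun t => x0 + vint u 0 t)^`()%classic t = u t}.
Proof.
move=> lu.
have : {ae mu, forall t, forall i, 0 < t ->
    h^-1 *: (\int[mu]_(s in `[0, h + t]) u s 0 i - \int[mu]_(s in `[0, t]) u s 0 i)
      @[h --> 0^'] --> u t 0 i}.
  apply: (@filter_forall _ _ _ _ (ae_filter_ringOfSetsType mu)) => i.
  exact: (ae_derive_integral (lu i)).
apply: (@filterS _ _ (ae_filter_ringOfSetsType mu)) => t tP t0; apply/derive1_cvgP.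
apply: cvg_coord => i; move: (tP i t0); apply: cvg_trans; apply: near_eq_cvg.
by near=> h; rewrite !mxE opprD addrACA subrr add0r.
Unshelve. all: by end_near. Qed.

Lemma continuous_derive_vint u (x0 : vec) t : vec_lbm u -> 0 < t ->
  {for t, continuous u} -> derivable (fun t => x0 + vint u 0 t) t 1 /\
    (fun t => x0 + vint u 0 t)^`()%classic t = u t.
Proof.
move=> lu t0 cu; apply/derive1_cvgP.
apply: cvg_coord => i.
have cui : {for t, continuous (fun s => u s 0 i)}.
  exact: (@continuous_comp R vec R u (fun x : vec => x 0 i) t cu
    (@coord_rV_continuous _ _ i (u t))).
have := continuous_derive_integral (lu i) t0 cui.
apply: cvg_trans; apply: near_eq_cvg.
by near=> h; rewrite !mxE opprD addrACA subrr add0r.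
Unshelve. all: by end_near. Qed.

End vector_integrals.

(** * Translation of null sets and Borel representatives *)

Section null_sets.
Context {R : realType}.
Notation mu := (@lebesgue_measure R).

Lemma measurable_shift (c : R) : measurable_fun setT (fun t : R => t + c).
Proof. by apply: measurable_funD; [exact: measurable_id|exact: measurable_cst]. Qed.

(** The pushforward of [mu] under the shift agrees with [mu] on half-open intervals, which determine
    the Lebesgue measure. *)
Lemma lebesgue_measure_shift (c : R) (A : set R) : measurable A ->
  mu ((fun t => t + c) @^-1` A) = mu A.
Proof.
move=> mA; have mshift : @measurable_fun _ _ (measurableTypeR R) (measurableTypeR R)
    setT (fun t : R => t + c) := measurable_shift c.
pose nu : {measure set (measurableTypeR R) -> \bar R} :=
  measure_function_pushforward__canonical__measure_function_Measure mu mshift.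
suff E X : ocitv X -> mu X = nu X by exact: esym (lebesgue_measure_unique E mA).
move=> [[a b] /= _ <-]; rewrite /pushforward (_ : _ @^-1` _ = `]a - c, b - c]%classic); last first.
  by apply/seteqP; split => t /=; rewrite !in_itv /= ltrBlDr lerBrDr.
rewrite !lebesgue_measure_itv /= !lte_fin ltrD2r; case: ifP => // _.
by rewrite -!EFinB; congr (_%:E); ring.
Qed.

Lemma ae_shift (P : R -> Prop) (c : R) :
  {ae mu, forall t, P t} -> {ae mu, forall t, P (t + c)}.
Proof.
move=> [A [mA A0 PA]]; exists ((fun t => t + c) @^-1` A); split.
- rewrite -[X in measurable X]setTI; exact: measurable_shift.
- by rewrite -[RHS]A0; exact: lebesgue_measure_shift.
- by move=> t /= nP; apply: PA.
Qed.

(** The Caratheodory sigma-algebra is the completion of the Borel one: [A] is a Borel set together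
    with a part of a null Borel set. *)
Lemma lebesgue_set_decomp (A : set (lebesgueType R)) : measurable A ->
  exists B Z : set R, [/\ measurable B, measurable Z, mu Z = 0%E &
    forall t, ~ Z t -> (A t <-> B t)].
Proof.
move=> mA; have : completed_algebra_gen mu A.
  by rewrite -g_sigma_completed_algebra_genE completed_caratheodory_measurable.
move=> [B mB [N [Z [mZ Z0 NZ]]] BNA]; exists B, Z; split => // t nZ.
rewrite -BNA; split; last by left.
by move=> [//|/NZ].
Qed.

(* The integration library works with Borel functions, whereas the class C only asks for
   Lebesgue measurability: one null Borel set is removed for countably many functions. *)
Lemma borel_restriction (D : set R) (u : nat -> R -> R) : measurable D ->
  (forall k, measurable_fun (D : set (lebesgueType R)) (u k : lebesgueType R -> R)) ->
  exists Z : set R, [/\ measurable Z, mu Z = 0%E &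
    forall k, measurable_fun setT (u k \_ (D `\` Z))].
Proof.
move=> mD mu_u.
have mDl : measurable (D : set (lebesgueType R)) by exact: sub_caratheodory.
have /choice[BZ BZP] : forall kq : nat * rat, exists BZ : set R * set R,
    [/\ measurable BZ.1, measurable BZ.2, mu BZ.2 = 0%E &
    forall t, ~ BZ.2 t -> ((D t /\ ratr kq.2 < u kq.1 t) <-> BZ.1 t)].
  move=> [k q] /=.
  have : measurable (D `&` u k @^-1` `]ratr q, +oo[ : set (lebesgueType R)).
    exact: mu_u.
  move=> /lebesgue_set_decomp[B [Z [mB mZ Z0 BZ]]]; exists (B, Z); split => //= t nZ.
  by rewrite -BZ//= in_itv /= andbT.
pose kq i : nat * rat := odflt (0%N, 0) (unpickle i).
pose Z := \bigcup_i (BZ (kq i)).2.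
have mZ : measurable Z by apply: bigcupT_measurable => i; have [] := BZP (kq i).
exists Z; split => //.
  apply/negligibleP => //; apply: negligible_bigcup => i.
  by have [_ mZi Zi0 _] := BZP (kq i); exists (BZ (kq i)).2; split.
move=> k; apply/(measurable_restrictT _ _).1; first exact: measurableD.
move=> mDZ; apply: (measurability _ (RGenOInfty.measurableE R)) => //.
move=> _ [_ [a ->] <-].
(* Only rational levels were decomposed, since null sets may be united only countably often. A value
   exceeds the real level [a] exactly if it exceeds some rational above [a]. *)
rewrite (_ : _ `&` _ = \bigcup_(q : rat)
    (if a < ratr q then (D `\` Z) `&` (BZ (k, q)).1 else set0)).
  apply: bigcupT_measurable_rat => q; case: ifP => _ //.
  by apply: measurableI; [exact: measurableD|have [] := BZP (k, q)].
have nZk t q : ~ Z t -> ~ (BZ (k, q)).2 t.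
  by move=> nZ Zt; apply: nZ; exists (pickle (k, q)) => //; rewrite /kq pickleK.
apply/seteqP; split => t /=; rewrite in_itv /= andbT.
  move=> [[Dt nZt] /rat_in_itvoo[q]]; rewrite in_itv /= => /andP[aq qu].
  exists q => //; rewrite aq; split => //.
  by have [_ _ _ /(_ t (nZk t q nZt))<-] := BZP (k, q).
move=> [q _]; case: ifP => // aq [[Dt nZt]].
have [_ _ _ /(_ t (nZk t q nZt))<-] := BZP (k, q) => -[_ qu].
by split => //; exact: lt_trans aq qu.
Qed.

End null_sets.

(** * Limits of Euler polygons *)

Section grid.
Context {R : realType}.
Implicit Types (t b : R) (N i : nat).

Definition mesh N : R := N.+1%:R^-1.

(** [truncn] is 0 on negative numbers: curves built on the grid are constant for [t <= 0]. *)
Definition grid_index N t : nat := Num.truncn (t * N.+1%:R).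

Definition grid_pt N i : R := i%:R * mesh N.

Lemma mesh_gt0 N : 0 < mesh N.
Proof. by rewrite /mesh invr_gt0 ltr0n. Qed.

Lemma mesh_cvg0 : mesh N @[N --> \oo] --> (0 : R).
Proof. exact: cvg_harmonic. Qed.

Lemma grid_ptS N i : grid_pt N i.+1 = grid_pt N i + mesh N.
Proof. by rewrite /grid_pt -natr1 mulrDl mul1r. Qed.

Lemma grid_pt_ge0 N i : 0 <= grid_pt N i.
Proof. by rewrite mulr_ge0// ltW// mesh_gt0. Qed.

Lemma grid_pt_le N i j : (i <= j)%N -> grid_pt N i <= grid_pt N j.
Proof. by move=> ij; rewrite ler_pM2r ?mesh_gt0// ler_nat. Qed.

Lemma grid_index_pt N i : grid_index N (grid_pt N i) = i.
Proof.
rewrite /grid_index /grid_pt /mesh mulfVK ?pnatr_eq0//.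
by apply: truncn_def; rewrite lexx ltr_nat /=.
Qed.

Lemma grid_index_itv N t : 0 <= t ->
  grid_pt N (grid_index N t) <= t < grid_pt N (grid_index N t) + mesh N.
Proof.
move=> t0; rewrite -grid_ptS /grid_pt /mesh ler_pdivrMr// ltr_pdivlMr//.
by apply: truncn_itv; rewrite mulr_ge0.
Qed.

Lemma grid_index_neg N t : t <= 0 -> grid_index N t = 0%N.
Proof.
move=> t0; apply/eqP; rewrite -leqn0 /grid_index truncn_le_nat.
by rewrite (le_lt_trans _ ltr01)// mulr_le0_ge0.
Qed.

Lemma grid_pt_index_dist N t t' :
  `|grid_pt N (grid_index N t) - grid_pt N (grid_index N t')| <= `|t - t'| + mesh N.
Proof.
wlog tt' : t t' / t' <= t.
  by move=> H; have [/H//|/ltW/H] := leP t' t; rewrite distrC (distrC t').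
have m0 := mesh_gt0 N.
rewrite (ger0_norm (_ : 0 <= t - t')) ?subr_ge0//.
have [t0|t0] := leP t 0.
  rewrite !grid_index_neg// ?(le_trans tt')// subrr normr0.
  by rewrite addr_ge0 ?subr_ge0// ltW.
have /andP[h1 h2] := @grid_index_itv N t (ltW t0).
have [t'0|t'0] := leP t' 0.
  rewrite (grid_index_neg N t'0) /grid_pt mul0r subr0 ger0_norm ?grid_pt_ge0//.
  by rewrite /grid_pt in h1; lra.
have /andP[h3 h4] := @grid_index_itv N t' (ltW t'0).
by rewrite ler_norml; apply/andP; split; lra.
Qed.

Lemma measurable_grid_index N j : measurable [set t : R | grid_index N t = j].
Proof.
have lt_meas k : measurable [set t : R | (k < grid_index N t)%N].
  rewrite (_ : [set _ | _] = `[k.+1%:R * mesh N, +oo[%classic); first exact: measurable_itv.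
  apply/seteqP; split => t /=; rewrite in_itv /= andbT /grid_index truncn_gt_nat;
    by rewrite /mesh ler_pdivrMr.
rewrite (_ : [set _ | _] = (if j is k.+1 then [set t : R | (k < grid_index N t)%N] else setT)
   `\` [set t : R | (j < grid_index N t)%N]).
  by apply: measurableD => //; case: (j).
case: j => [|j]; apply/seteqP; split => t /=.
- by move->; split.
- by move=> [_ /negP]; rewrite -leqNgt leqn0 => /eqP.
- by move=> ->; rewrite ltnn; split.
- by move=> [jt /negP]; rewrite -leqNgt => tj; apply/eqP; rewrite eqn_leq tj.
Qed.

Lemma measurable_patchwork (p : R -> nat) (g : nat -> R -> R) :
  (forall j, measurable [set t : R | p t = j]) ->
  (forall j, measurable_fun setT (g j)) -> measurable_fun setT (fun t => g (p t) t).
Proof.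
move=> mp mg _ B mB; rewrite setTI.
rewrite (_ : _ @^-1` B = \bigcup_j ([set t | p t = j] `&` (g j @^-1` B))).
  apply: bigcupT_measurable => j; apply: measurableI => //.
  by rewrite -[X in measurable X]setTI; exact: mg.
apply/seteqP; split => t /=; first by move=> Bt; exists (p t).
by move=> [j _ [<-]].
Qed.

End grid.

(** * Existence of solutions for fields measurable in time *)

Section caratheodory.
Context {R : realType} {n : nat}.
Notation mu := (@lebesgue_measure R).
Notation vec := 'rV[R]_n.
Variables (f : R -> vec -> vec) (C : R).

Definition borel_in_time := forall x i, measurable_fun setT (fun t => f t x 0 i).
Definition equicont_in_space := forall r e : R, 0 < e -> exists2 d : R, 0 < d &
  forall t (x1 x2 : vec), `|x1| <= r -> `|x2| <= r -> `|x1 - x2| < d -> `|f t x1 - f t x2| <= e.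
Definition linear_growth := 0 < C /\ forall t (x : vec), `|f t x| <= C * (1 + `|x|).

Hypothesis f_meas : borel_in_time.
Hypothesis f_equi : equicont_in_space.
Hypothesis f_growth : linear_growth.

Let C0 : 0 < C. Proof. by case: f_growth. Qed.

Let f_bound t x b : `|x| <= b -> `|f t x| <= C * (1 + b).
Proof.
by move=> xb; rewrite (le_trans (f_growth.2 t x))// ler_pM2l// lerD2l.
Qed.

Lemma vec_lbm_cst x : vec_lbm (fun t => f t x).
Proof.
move=> i; split; first exact: f_meas.
by move=> b; exists (C * (1 + `|x|)) => t _; rewrite (le_trans (norm_coord _ _))// f_bound.
Qed.

(** Freezing [y] at grid points gives a countable patchwork of functions measurable in time, and
    equicontinuity yields pointwise convergence as the mesh shrinks. Constancy for [t <= 0] matches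
    the grid, which sends negative times to index 0. *)
Lemma vec_lbm_comp (y : R -> vec) :
  continuous y -> (forall b : R, exists M : R, forall t, `|t| <= b -> `|y t| <= M) ->
  (forall t, t <= 0 -> y t = y 0) ->
  vec_lbm (fun t => f t (y t)).
Proof.
move=> cy by_ yneg i; split; last first.
  move=> b; have [M MP] := by_ b; exists (C * (1 + M)) => t /MP tM.
  by rewrite (le_trans (norm_coord _ _))// f_bound.
apply: (@measurable_fun_cvg _ _ _ _ (fun N t => f t (y (grid_pt N (grid_index N t))) 0 i)).
  move=> N; apply: (@measurable_patchwork _ (grid_index N) (fun j t => f t (y (grid_pt N j)) 0 i)).
    exact: measurable_grid_index.
  by move=> j; exact: f_meas.
move=> t _; apply/cvgrPdist_le => e e0.
have [M MP] := by_ (`|t| + 1).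
have [d d0 dP] := f_equi M e0.
(* Grid points are never negative and so approximate [Num.max t 0], where [y] has the same value as
   at [t]. *)
have yt : y (Num.max t 0) = y t.
  by have [t0|t0] := leP t 0; rewrite ?max_r ?max_l ?ltW// yneg.
have := cy (Num.max t 0) => /cvgrPdist_lt/(_ d d0)/nbhs_ballP[d' /= d'0 d'P].
have m1 : 0 < Num.min d' 1 by rewrite lt_min d'0 ltr01.
have := @mesh_cvg0 R => /cvgrPdist_lt/(_ _ m1).
apply: filterS => N; rewrite sub0r normrN gtr0_norm ?mesh_gt0// lt_min => /andP[md m1'].
have near_t : `|Num.max t 0 - grid_pt N (grid_index N t)| < mesh N.
  have [t0|t0] := leP t 0.
    by rewrite grid_index_neg// /grid_pt mul0r subrr normr0 mesh_gt0.
  have /andP[h1 h2] := @grid_index_itv _ N t (ltW t0).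
  by rewrite ltr_norml; apply/andP; split; have := @mesh_gt0 R N; lra.
have := norm_coord (f t (y t) - f t (y (grid_pt N (grid_index N t)))) i.
rewrite !mxE => h; apply: le_trans h _; apply: dP.
- by apply: MP; lra.
- apply: MP; rewrite ger0_norm ?grid_pt_ge0//.
  have [t0|t0] := leP t 0.
    by rewrite grid_index_neg// /grid_pt mul0r addr_ge0.
  have /andP[h1 h2] := @grid_index_itv _ N t (ltW t0).
  by rewrite (le_trans h1)// (le_trans (ler_norm _))// lerDl.
- rewrite -yt; apply: d'P; rewrite -ball_normE /=; exact: lt_trans near_t md.
Qed.


Section euler.
(** The nodes [x] are separated from the points [s] where the slope is taken: [s] is a nearest point
    of [S] in proximal aiming and the node itself in the plain scheme, and one limit theorem covers
    both. *)
Variables (x0 : vec) (x s : nat -> nat -> vec) (e : nat -> R).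
Hypothesis x_init : forall N, x N 0 = x0.
Hypothesis x_step : forall N i,
  x N i.+1 = x N i + vint (fun t => f t (s N i)) (grid_pt N i) (grid_pt N i.+1).
Hypothesis s_near : forall N i, `|s N i - x N i| <= e N.
Hypothesis e_cvg : e N @[N --> \oo] --> (0 : R).
Hypothesis e_le1 : forall N, e N <= 1.

(* [B b] bounds the nodes up to time [b] (discrete Gronwall) and [M b] their speed; the 2 leaves
   room for the distance at most 1 between a node and the point where its slope is taken. *)
Let B b : R := (2 + `|x0|) * expR (C * b).
Let M b : R := C * (1 + B b).

Let B_le b b' : b <= b' -> B b <= B b'.
Proof.
by move=> bb'; rewrite ler_wpM2l ?addr_ge0// ler_expR ler_pM2l.
Qed.

Let M_ge0 b : 0 <= M b.
Proof. by rewrite mulr_ge0 ?(ltW C0)// addr_ge0// mulr_ge0 ?addr_ge0// expR_ge0. Qed.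

Let s_le N i : `|s N i| <= `|x N i| + 1.
Proof.
rewrite -[s N i](subrK (x N i)) addrC (le_trans (ler_normD _ _))// lerD2l.
exact: le_trans (s_near N i) (e_le1 N).
Qed.

Let step_le N i : `|x N i.+1 - x N i| <= mesh N * (C * (2 + `|x N i|)).
Proof.
rewrite x_step addrC addKr.
rewrite (le_trans (@vint_norm _ _ _ _ _ (C * (2 + `|x N i|)) (vec_lbm_cst _) _ _))//.
- by apply: grid_pt_le.
- move=> t _; rewrite (le_trans (f_bound t (s_le N i)))//.
  by rewrite (_ : 1 + _ = 2 + `|x N i|)//; ring.
- by rewrite grid_ptS addrAC subrr add0r.
Qed.

(** One step multiplies the left-hand side by at most [1 + C * mesh N], which is below
    [expR (C * mesh N)]. *)
Let x_gronwall N i : 2 + `|x N i| <= B (grid_pt N i).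
Proof.
elim: i => [|i IH]; first by rewrite x_init /B /grid_pt mul0r mulr0 expR0 mulr1.
have : `|x N i.+1| <= `|x N i| + mesh N * (C * (2 + `|x N i|)).
  rewrite -[x N i.+1](subrK (x N i)) addrC (le_trans (ler_normD _ _))//.
  by rewrite lerD2l step_le.
move=> h; rewrite (@le_trans _ _ ((2 + `|x N i|) * (1 + C * mesh N)))//.
  by apply: (@le_trans _ _ (2 + (`|x N i| + mesh N * (C * (2 + `|x N i|)))));
    [rewrite lerD2l|lra].
rewrite [leRHS](_ : _ = B (grid_pt N i) * expR (C * mesh N)); last first.
  by rewrite /B grid_ptS (mulrDr C) expRD mulrA.
rewrite ler_pM//.
- by rewrite addr_ge0// mulr_ge0// ?(ltW C0) ?(ltW (mesh_gt0 N)).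
- exact: expR_ge1Dx.
Qed.

Let x_le N i b : grid_pt N i <= b -> `|x N i| <= B b - 2.
Proof. by move=> ib; have := x_gronwall N i; have := B_le ib; lra. Qed.

Let s_leB N i b : grid_pt N i <= b -> `|s N i| <= B b.
Proof. by move=> /x_le; have := s_le N i; lra. Qed.

Let x_lip N i j b : (i <= j)%N -> grid_pt N j <= b ->
  `|x N j - x N i| <= M b * (grid_pt N j - grid_pt N i).
Proof.
elim: j => [|j IH].
  by rewrite leqn0 => /eqP -> _; rewrite !subrr normr0 mulr0.
rewrite leq_eqVlt => /predU1P[->|]; first by rewrite !subrr normr0 mulr0.
rewrite ltnS => ij jb.
have jb' : grid_pt N j <= b by apply: le_trans (grid_pt_le _ (leqnSn j)) jb.
rewrite -(subrKA (x N j)) (le_trans (ler_normD _ _))//.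
have := IH ij jb'; have := step_le N j; rewrite grid_ptS.
have : mesh N * (C * (2 + `|x N j|)) <= mesh N * M b.
  rewrite ler_pM2l ?mesh_gt0// ler_pM2l//.
  by have := x_le jb'; lra.
lra.
Qed.

(** A step function replaces the interpolated polygon; its jumps cost an extra [mesh N] in the
    Lipschitz estimate, which disappears in the limit. *)
Let Y (N : nat) (t : R) := x N (grid_index N t).

Let gridp (N : nat) (t : R) : R := grid_pt N (grid_index N t).

Let gridp_le N t b : 0 <= b -> t <= b -> gridp N t <= b.
Proof.
move=> b0 tb; have [t0|t0] := leP t 0.
  by rewrite /gridp grid_index_neg// /grid_pt mul0r.
by have /andP[h _] := @grid_index_itv R N t (ltW t0); rewrite (le_trans h).
Qed.

Let Y_lip N t t' b : 0 <= b -> t <= b -> t' <= b ->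
  `|Y N t - Y N t'| <= M b * (`|t - t'| + mesh N).
Proof.
move=> b0 tb t'b; rewrite (@le_trans _ _ (M b * `|gridp N t - gridp N t'|))//; last first.
  by rewrite ler_wpM2l// grid_pt_index_dist.
have [ij|/ltnW ij] := leqP (grid_index N t) (grid_index N t').
  rewrite distrC (distrC (gridp N t)) (@ger0_norm _ (_ - gridp N t)) ?subr_ge0 ?grid_pt_le//.
  by apply: x_lip => //; exact: gridp_le.
rewrite (@ger0_norm _ (_ - gridp N t')) ?subr_ge0 ?grid_pt_le//.
by apply: x_lip => //; exact: gridp_le.
Qed.

Let Y_le N t b : 0 <= b -> t <= b -> `|Y N t| <= B b.
Proof. by move=> b0 tb; have := x_le (gridp_le N b0 tb); lra. Qed.

(* The pointwise limit along an ultrafilter finer than [\oo] replaces the extraction of a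
   subsequence by Arzela-Ascoli; equicontinuity makes it locally uniform. *)
Section ultralimit.
Variables (G : set_system nat) (G_ultra : UltraFilter G) (G_oo : \oo `<=` G).

Let GF : ProperFilter G. Proof. exact: ultra_proper. Qed.

(** The values stay in a compact ball, hence cluster there, and a cluster point of an ultrafilter is
    a limit. *)
Lemma ultralimit_exists t : exists l : vec, Y N t @[N --> G] --> l.
Proof.
have [b b0 tb] : exists2 b : R, 0 <= b & t <= b.
  by exists `|t|; [exact: normr_ge0|exact: ler_norm].
have Yb N : `|0 - Y N t| <= B b by rewrite sub0r normrN; exact: Y_le.
have YG : (Y N t @[N --> G]) [set z | `|0 - z| <= B b] by apply: (@filterE _ G) => N; exact: Yb.
have [l [_ lc]] := closed_ball_compact (fmap_proper_filter _ _) YG.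
exists l => V lV; rewrite /= nbhs_filterE.
have [//|GV] := in_ultra_setVsetC (Y^~ t @^-1` V) G_ultra.
have [z [Vz1 Vz2]] := lc (~` V) V GV lV.
by [].
Qed.

Let y (t : R) := sval (cid (ultralimit_exists t)).

Let y_cvg t : Y N t @[N --> G] --> y t.
Proof. by rewrite /y; case: cid. Qed.

Let Y_near t d : 0 < d -> \forall N \near G, `|y t - Y N t| < d.
Proof. by move=> d0; move: (@y_cvg t) => /cvgrPdist_lt/(_ d d0). Qed.

Let mesh_near d : 0 < d -> \forall N \near G, (mesh N : R) < d.
Proof.
move=> d0; apply: G_oo; have := @mesh_cvg0 R => /cvgrPdist_lt/(_ d d0).
by apply: filterS => N; rewrite sub0r normrN gtr0_norm ?mesh_gt0.
Qed.

Let e_near d : 0 < d -> \forall N \near G, e N < d.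
Proof.
move=> d0; apply: G_oo; have := e_cvg => /cvgrPdist_lt/(_ d d0).
by apply: filterS => N; rewrite sub0r normrN; apply: le_lt_trans; exact: ler_norm.
Qed.

Let y_neg t : t <= 0 -> y t = x0.
Proof.
move=> t0; apply/eqP; rewrite -subr_eq0 -normr_le0; apply/ler_addgt0Pr => d d0.
have [N] := filter_ex (Y_near t d0).
by rewrite /Y grid_index_neg// x_init add0r => /ltW.
Qed.

Let y_le t b : 0 <= b -> t <= b -> `|y t| <= B b.
Proof.
move=> b0 tb; apply/ler_addgt0Pr => d d0.
have [N yN] := filter_ex (Y_near t d0).
have := Y_le N b0 tb; have := ler_normD (y t - Y N t) (Y N t); rewrite subrK; lra.
Qed.

Let y_lip t t' b : 0 <= b -> t <= b -> t' <= b -> `|y t - y t'| <= M b * `|t - t'|.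
Proof.
move=> b0 tb t'b; apply/ler_addgt0Pr => d d0.
have M1 : 0 < M b + 1 by rewrite ltr_wpDl.
have d30 : 0 < d / 3 by lra.
have d3M : 0 < d / 3 / (M b + 1) by rewrite divr_gt0.
have [N [[yN yN'] mN]] :=
  filter_ex (filterI (filterI (Y_near t d30) (Y_near t' d30)) (mesh_near d3M)).
have -> : y t - y t' = (y t - Y N t) + ((Y N t - Y N t') - (y t' - Y N t')).
  by apply/rowP => i; rewrite !mxE; ring.
have := ler_normD (y t - Y N t) ((Y N t - Y N t') - (y t' - Y N t')).
have := ler_normB (Y N t - Y N t') (y t' - Y N t').
have := Y_lip N b0 tb t'b.
have : M b * mesh N <= d / 3.
  rewrite (@le_trans _ _ ((M b + 1) * mesh N))//.
    by rewrite ler_pM2r ?mesh_gt0// lerDl.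
  by rewrite mulrC -ler_pdivlMr// ltW.
rewrite mulrDr; lra.
Qed.

Let y_continuous : continuous y.
Proof.
move=> t; apply/cvgrPdist_lt => d d0.
set b := `|t| + 1; have b0 : 0 <= b by rewrite addr_ge0.
have tb : t <= b by have := ler_norm t; rewrite /b; lra.
have M1 : 0 < M b + 1 by rewrite ltr_wpDl.
have r0 : 0 < Num.min 1 (d / (M b + 1)) by rewrite lt_min ltr01 divr_gt0.
apply/nbhs_ballP; exists (Num.min 1 (d / (M b + 1))) => //= t'.
rewrite /ball_ /= lt_min => /andP[tt1 ttd].
have t'b : t' <= b.
  have := ler_norm t; move: tt1; rewrite ltr_norml /b => /andP[h1 h2]; lra.
rewrite (le_lt_trans (y_lip b0 tb t'b))// (@le_lt_trans _ _ ((M b + 1) * `|t - t'|))//.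
  by rewrite ler_wpM2r// lerDl.
by rewrite mulrC -ltr_pdivlMr.
Qed.

(** A fixed auxiliary mesh leaves finitely many times at which convergence holds simultaneously; the
    Lipschitz bounds carry it to the times between. The four quarters of [d] pay for the grid value,
    the motion of [y], the motion of [Y] and its jumps. *)
Let uniform_near b d : 0 <= b -> 0 < d ->
  \forall N \near G, forall t : R, 0 <= t -> t <= b -> `|y t - Y N t| <= d.
Proof.
move=> b0 d0; have M1 : 0 < M b + 1 by rewrite ltr_wpDl.
have d4M : 0 < d / 4 / (M b + 1) by rewrite !divr_gt0.
have [m mP] : exists m, (mesh m : R) < d / 4 / (M b + 1) by exact: filter_ex (mesh_near d4M).
pose K := (grid_index m b).+1.
have d40 : 0 < d / 4 by lra.
have : \forall N \near G, forall j : 'I_K, `|y (grid_pt m j) - Y N (grid_pt m j)| < d / 4.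
  by apply: filter_forall => j; exact: Y_near.
apply: filterS2 (mesh_near d4M) => N mN gN t t0 tb.
have jK : (grid_index m t < K)%N.
  rewrite ltnS truncn_ge_nat ?mulr_ge0//.
  by rewrite (le_trans (_ : _ <= t * m.+1%:R))// ?truncn_le ?mulr_ge0// ler_pM2r.
have := gN (Ordinal jK) => /=; set r := grid_pt m _ => yr.
have /andP[rt tr] : r <= t < r + mesh m by exact: grid_index_itv.
have rb : r <= b by exact: le_trans rt tb.
have -> : y t - Y N t = (y t - y r) + ((y r - Y N r) - (Y N t - Y N r)).
  by apply/rowP => i; rewrite !mxE; ring.
have trm : `|t - r| <= mesh m by rewrite ger0_norm ?subr_ge0//; lra.
have := ler_normD (y t - y r) ((y r - Y N r) - (Y N t - Y N r)).
have := ler_normB (y r - Y N r) (Y N t - Y N r).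
have := Y_lip N b0 tb rb; have := y_lip b0 tb rb; rewrite mulrDr.
have small z : z <= d / 4 / (M b + 1) -> 0 <= z -> M b * z <= d / 4.
  move=> zd z0; rewrite (@le_trans _ _ ((M b + 1) * z))//.
    by rewrite ler_wpM2r// lerDl.
  by rewrite mulrC -ler_pdivlMr.
have := small _ (ltW mN) (ltW (mesh_gt0 N)).
have := small _ (le_trans trm (ltW mP)) (normr_ge0 _).
lra.
Qed.

Let y_bounded (b : R) : exists K : R, forall t, `|t| <= b -> `|y t| <= K.
Proof.
exists (B `|b|) => t tb; apply: y_le => //.
by rewrite (le_trans (ler_norm _))// (le_trans tb)// ler_norm.
Qed.

Let Fy (t : R) := f t (y t).

Let Fy_lbm : vec_lbm Fy.
Proof.
apply: (vec_lbm_comp y_continuous y_bounded) => t t0.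
by rewrite !y_neg.
Qed.

Let Fy_le t b : 0 <= b -> t <= b -> `|Fy t| <= M b.
Proof. by move=> b0 tb; apply: f_bound; exact: y_le. Qed.

(** During each step the slope point is within [r] of [y t], so the integrands differ by at most [d]
    and the errors add up to [d] times the elapsed time. The thirds of [r] cover the slope offset,
    the convergence at the node and the motion of [y]. *)
Let node_approx b d : 0 <= b -> 0 < d -> \forall N \near G, forall i,
  (grid_pt N i : R) <= b -> `|x N i - x0 - vint Fy 0 (grid_pt N i)| <= grid_pt N i * d.
Proof.
move=> b0 d0; have [r r0 rP] := f_equi (B b) d0.
have r30 : 0 < r / 3 by lra.
have M1 : 0 < M b + 1 by rewrite ltr_wpDl.
have r3M : 0 < r / 3 / (M b + 1) by rewrite divr_gt0.
apply: filterS3 (e_near r30) (mesh_near r3M) (uniform_near b0 r30) => N eN mN uN.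
elim => [|i IH] ib.
  rewrite x_init subrr sub0r normrN /grid_pt !mul0r.
  rewrite (le_trans (@vint_norm _ _ _ _ _ (M b) Fy_lbm _ _))//.
    by move=> t /andP[t0 t1]; apply: Fy_le => //; exact: le_trans t1 b0.
  by rewrite subrr mul0r.
have ib' : grid_pt N i <= b by apply: le_trans (grid_pt_le _ (leqnSn i)) ib.
have ii : grid_pt N i <= grid_pt N i.+1 :> R by exact: grid_pt_le.
rewrite x_step (vint_split Fy_lbm (grid_pt_ge0 N i) ii).
have -> : forall u v w z : vec, u + v - x0 - (w + z) = (u - x0 - w) + (v - z).
  by move=> u v w z; apply/rowP => k; rewrite !mxE; ring.
apply: le_trans (ler_normD _ _) _.
rewrite [in leRHS]grid_ptS mulrDl; apply: lerD; first exact: IH.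
rewrite (_ : mesh N * d = (grid_pt N i.+1 - grid_pt N i) * d); last first.
  by rewrite grid_ptS addrAC subrr add0r.
apply: vint_dist => //; first exact: vec_lbm_cst.
move=> t /andP[it ti]; have tb : t <= b by exact: le_trans ti ib.
apply: rP; [exact: s_leB|exact: y_le|].
have -> : s N i - y t = (s N i - x N i) - (y (grid_pt N i) - Y N (grid_pt N i))
    - (y t - y (grid_pt N i)).
  by rewrite /Y grid_index_pt; apply/rowP => k; rewrite !mxE; ring.
have := ler_normB (s N i - x N i - (y (grid_pt N i) - Y N (grid_pt N i))) (y t - y (grid_pt N i)).
have := ler_normB (s N i - x N i) (y (grid_pt N i) - Y N (grid_pt N i)).
have := uN _ (grid_pt_ge0 N i) ib'; have := s_near N i.
have := y_lip b0 tb ib'.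
have tm : `|t - grid_pt N i| <= mesh N.
  by rewrite ger0_norm ?subr_ge0//; rewrite grid_ptS in ti; lra.
have : M b * `|t - grid_pt N i| < r / 3.
  rewrite (@le_lt_trans _ _ ((M b + 1) * mesh N))//.
    by rewrite ler_pM// lerDl.
  by rewrite mulrC -ltr_pdivlMr.
lra.
Qed.

Let y_integral t : 0 <= t -> y t = x0 + vint Fy 0 t.
Proof.
move=> t0; apply/eqP; rewrite -subr_eq0 -normr_le0; apply/ler_addgt0Pr => d d0.
rewrite add0r.
have M1 : 0 < M t + 1 by rewrite ltr_wpDl.
have d30 : 0 < d / 3 by lra.
have d3M : 0 < d / 3 / (M t + 1) by rewrite divr_gt0.
have t1 : 0 < t + 1 by lra.
have d3t : 0 < d / 3 / (t + 1) by rewrite divr_gt0.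
have [N [yN [mN nN]]] := filter_ex (filterI (Y_near t d30)
  (filterI (mesh_near d3M) (node_approx t0 d3t))).
have /andP[h1 h2] := @grid_index_itv R N t t0; rewrite -/(gridp N t) in h1 h2.
have := nN _ h1; rewrite -/(gridp N t) -/(Y N t) => nNt.
have g0 : 0 <= gridp N t by exact: grid_pt_ge0.
rewrite (vint_split Fy_lbm g0 h1).
have -> : y t - (x0 + (vint Fy 0 (gridp N t) + vint Fy (gridp N t) t)) =
    (y t - Y N t) + ((Y N t - x0 - vint Fy 0 (gridp N t)) - vint Fy (gridp N t) t).
  by apply/rowP => i; rewrite !mxE; ring.
rewrite (le_trans (ler_normD _ _))// (_ : d = d / 3 + (d / 3 + d / 3)); last by field.
rewrite lerD ?(ltW yN)// (le_trans (ler_normB _ _))// lerD//.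
  rewrite (le_trans nNt)// mulrA ler_pdivrMr// mulrC ler_wpM2l ?(ltW d30)//.
  by rewrite (le_trans h1)// lerDl.
apply: (@le_trans _ _ ((t - gridp N t) * M t)).
  by apply: vint_norm => // r /andP[_ rt]; exact: Fy_le.
rewrite (@le_trans _ _ (mesh N * (M t + 1)))//.
  rewrite ler_pM ?subr_ge0// ?lerDl//.
  by rewrite lerBlDl ltW.
by rewrite -ler_pdivlMr// ltW.
Qed.

(** The last clause keeps of the ultrafilter only that arbitrarily fine polygons come close to
    [y t]; this is what passing to a limit in a closed set requires. *)
Lemma euler_ultralimit : exists y : R -> vec,
  [/\ continuous y, vec_lbm (fun t => f t (y t)),
      (forall b, exists K : R, forall t, `|t| <= b -> `|f t (y t)| <= K),
      (forall t, 0 <= t -> y t = x0 + vint (fun t => f t (y t)) 0 t) &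
      forall t d N0, 0 <= t -> 0 < d ->
        exists2 N, (N0 <= N)%N & `|y t - x N (grid_index N t)| < d].
Proof.
exists y; split; [exact: y_continuous|exact: Fy_lbm| |exact: y_integral|].
  move=> b; exists (M `|b|) => t tb; apply: Fy_le => //.
  by rewrite (le_trans (ler_norm _))// (le_trans tb)// ler_norm.
move=> t d N0 t0 d0.
have N0G : \forall N \near G, (N0 <= N)%N by apply: G_oo; exists N0.
by have [N [h1 h2]] := filter_ex (filterI N0G (Y_near t d0)); exists N.
Qed.

End ultralimit.

Lemma euler_limit : exists y : R -> vec,
  [/\ continuous y, vec_lbm (fun t => f t (y t)),
      (forall b, exists K : R, forall t, `|t| <= b -> `|f t (y t)| <= K),
      (forall t, 0 <= t -> y t = x0 + vint (fun t => f t (y t)) 0 t) &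
      forall t d N0, 0 <= t -> 0 < d ->
        exists2 N, (N0 <= N)%N & `|y t - x N (grid_index N t)| < d].
Proof.
have [G [G_ultra G_oo]] := @ultraFilterLemma nat \oo _.
exact: euler_ultralimit G_ultra G_oo.
Qed.

End euler.

End caratheodory.

(** * Proximal aiming and the sufficiency part *)

Section absolute_continuity.
Context {R : realType} {n : nat}.
Notation vec := 'rV[R]_n.
Implicit Types (phi : R -> vec) (a b c : R).

Lemma lipschitz_absolutely_continuous a b K phi :
  (forall s t, a <= s -> s <= t -> t <= b -> `|phi t - phi s| <= K * (t - s)) ->
  absolutely_continuous a b phi.
Proof.
move=> lip e e0; have K0 : 0 < n%:R * `|K| + 1 by rewrite ltr_wpDl// mulr_ge0.
exists (e / (n%:R * `|K| + 1)); first by rewrite divr_gt0.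
move=> m u v uv _ small.
apply: (@le_lt_trans _ _ ((n%:R * `|K| + 1) * \sum_(i < m) (v i - u i))); last first.
  by rewrite mulrC -ltr_pdivlMr.
rewrite mulr_sumr; apply: ler_sum => i _.
have [au [uvi vb]] := uv i.
rewrite (le_trans (enorm_le_norm _))// (@le_trans _ _ (n%:R * (`|K| * (v i - u i))))//.
  rewrite ler_wpM2l// (le_trans (lip _ _ au uvi vb))// ler_wpM2r ?subr_ge0//.
  exact: ler_norm.
by rewrite mulrA ler_wpM2r ?subr_ge0// lerDl.
Qed.

Lemma absolutely_continuous_modulus a b phi : absolutely_continuous a b phi ->
  forall e, 0 < e -> exists2 d : R, 0 < d & forall s t, a <= s -> s <= t -> t <= b ->
    t - s < d -> `|phi t - phi s| < e.
Proof.
move=> ac e e0; have [d d0 dP] := ac e e0; exists d => // s t as_ st tb std.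
have := dP 1%N (fun=> s) (fun=> t) (fun=> conj as_ (conj st tb)).
rewrite !big_ord1 => h; apply: le_lt_trans (norm_le_enorm _) _; apply: h => //.
by move=> i j _ _ _; rewrite !ord1.
Qed.

Lemma absolutely_continuous_shift a b c phi : absolutely_continuous (a + c) (b + c) phi ->
  absolutely_continuous a b (fun t => phi (t + c)).
Proof.
move=> ac e e0; have [d d0 dP] := ac e e0; exists d => // m u v uv triv small.
apply: (dP m (fun i => u i + c) (fun i => v i + c)).
- by move=> i; have [h1 [h2 h3]] := uv i; rewrite !lerD2r.
- move=> i j _ _ [t [/= ti tj]]; apply: triv => //; exists (t - c).
  move: ti tj; rewrite !in_itv /= => /andP[i1 i2] /andP[j1 j2].
  by split; rewrite /= in_itv /=; apply/andP; split; lra.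
- by under eq_bigr do rewrite addrKA opprK subrr addr0 || rewrite opprD addrACA subrr addr0.
Qed.

Lemma derivable_shift (phi : R -> vec) c t : derivable phi (t + c) 1 ->
  derivable (fun s => phi (s + c)) t 1 /\
  (fun s => phi (s + c))^`()%classic t = phi^`()%classic (t + c).
Proof.
move=> dphi; apply/derive1_cvgP.
have : derivable phi (t + c) 1 /\ phi^`()%classic (t + c) = phi^`()%classic (t + c) by [].
by move/derive1_cvgP; under eq_fun do rewrite addrA.
Qed.

Lemma derive_near_eq (phi psi : R -> vec) t l : (\forall s \near t, phi s = psi s) ->
  derivable phi t 1 /\ phi^`()%classic t = l -> derivable psi t 1 /\ psi^`()%classic t = l.
Proof.
move=> E /derive1_cvgP H; apply/derive1_cvgP.
apply: cvg_trans H; apply: near_eq_cvg.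
have [d /= d0 dE] := (nbhs_ballP _ _).1 E.
apply/nbhs_ballP; exists d => // h hd0 _ /=; have hd : `|0 - h| < d := hd0.
have Et : phi t = psi t by apply: dE; exact: ballxx.
rewrite Et; congr (_ *: (_ - _)).
by apply: dE; suff : `|t - (h + t)| < d by []; rewrite opprD addrCA subrr addr0 -sub0r.
Qed.

End absolute_continuity.

Section ivp.
Context {R : realType} {n : nat}.
Notation mu := (@lebesgue_measure R).
Notation vec := 'rV[R]_n.

Lemma vintxx (u : R -> vec) a : vint u a a = 0.
Proof.
apply/rowP => i; rewrite !mxE set_itv1.
exact: Rintegral_set1.
Qed.

Lemma integral_lipschitz (x0 : vec) (u y : R -> vec) (b K : R) : vec_lbm u ->
  (forall t, `|t| <= b -> `|u t| <= K) ->
  (forall t, 0 <= t -> y t = x0 + vint u 0 t) ->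
  forall s t, 0 <= s -> s <= t -> t <= b -> `|y t - y s| <= K * (t - s).
Proof.
move=> lu uK yE s t s0 st tb.
rewrite !yE ?(le_trans s0)// (vint_split lu s0 st).
rewrite (_ : _ - _ = vint u s t); last by apply/rowP => i; rewrite !mxE; ring.
rewrite mulrC; apply: vint_norm => // r /andP[sr rt]; apply: uK.
by rewrite ger0_norm ?(le_trans s0)// (le_trans rt).
Qed.

(** This leads back from the modified field [g], for which the integral equation is solved, to [f],
    to which uniqueness in (U) refers. *)
Lemma integral_ivp_solution (f : R -> vec -> vec) (g : R -> vec -> vec) (x0 : vec)
    (y : R -> vec) (T : R) (Z : set R) :
  measurable Z -> mu Z = 0%E ->
  (forall t, 0 <= t -> t <= T -> ~ Z t -> forall x, g t x = f t x) ->
  vec_lbm (fun t => g t (y t)) ->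
  (forall b, exists K : R, forall t, `|t| <= b -> `|g t (y t)| <= K) ->
  (forall t, 0 <= t -> y t = x0 + vint (fun t => g t (y t)) 0 t) ->
  ivp_solution f T x0 y.
Proof.
move=> mZ Z0 gf lu uK yE; split.
- have [K KP] := uK T.
  exact: lipschitz_absolutely_continuous (integral_lipschitz lu KP yE).
- by rewrite yE// vintxx addr0.
- have aeZ : {ae mu, forall t, ~ Z t} by exists Z; split => // t /= /contrapT.
  (* The integral formula for [y] is known only on the right of 0, so the two-sided derivative at
     time 0 is avoided. *)
  have ae0 : {ae mu, forall t : R, t != 0}.
    exists [set 0]; split; [exact: measurable_set1|exact: lebesgue_measure_set1|].
    by move=> t /= /negP; rewrite negbK => /eqP.
  have := ae_derive_vint x0 lu; move: aeZ ae0.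
  apply: (@filterS3 _ _ (ae_filter_ringOfSetsType mu)) => t nZ tn0 dt.
  rewrite in_itv /= => /andP[t0 tT].
  have {}t0 : 0 < t by rewrite lt_neqAle eq_sym tn0.
  rewrite -(gf t (ltW t0) tT nZ (y t)).
  apply: derive_near_eq (dt t0).
  near=> s; rewrite yE//; apply: ltW; near: s; exact: lt_nbhsr.
Unshelve. all: by end_near. Qed.

End ivp.

(** * Making the feedback Borel and its conditions valid at all times *)

Section borel_modification.
Context {R : realType} {n : nat}.
Notation mu := (@lebesgue_measure R).
Notation vec := 'rV[R]_n.

Lemma modulus_small (w : R -> R) (e : R) : modulus w -> 0 < e ->
  exists2 d : R, 0 < d & forall r, 0 <= r -> r < d -> w r < e.
Proof.
move=> [w0 wm wc w00] e0.
have w_r : w r @[r --> 0^'+] --> w 0.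
  have /continuous_within_itvcyP[_] := wc.
  by [].
move: w_r; rewrite w00 => /cvgrPdist_lt/(_ e e0) /nbhs_ballP[d /= d0 dP].
exists d => // r r0 rd; have [->|rn0] := eqVneq r 0; first by rewrite w00.
have r_gt0 : 0 < r by rewrite lt_neqAle eq_sym rn0.
have := dP r; rewrite /= sub0r normrN.
have -> : `|w r| = w r by rewrite ger0_norm// w0// in_itv /= r0.
by apply => //; suff : `|0 - r| < d by []; rewrite sub0r normrN gtr0_norm.
Qed.

Lemma classC_equicont (T : R) (f : R -> vec -> vec) (r e : R) : classC T f -> 0 < e ->
  exists2 d : R, 0 < d & forall t (x1 x2 : vec), 0 <= t <= T ->
    `|x1| <= r -> `|x2| <= r -> `|x1 - x2| < d -> `|f t x1 - f t x2| <= e.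
Proof.
move=> [_ fK _] e0.
have [w wmod wf] := fK _ (@closed_ball_compact R n 0 r).
have [d d0 dP] := modulus_small wmod e0.
(* [n%:R + 1] bounds the ratio of the two norms and, unlike [n%:R], is a positive divisor also for
   [n = 0]. *)
have n1 : 0 < n%:R + 1 :> R by rewrite ltr_wpDl.
exists (d / (n%:R + 1)); first by rewrite divr_gt0.
move=> t x1 x2 tT x1r x2r x12.
rewrite (le_trans (norm_le_enorm _))// (@le_trans _ _ (w (enorm (x1 - x2))))//.
  by apply: wf; rewrite ?in_itv//= sub0r normrN.
apply/ltW/dP; first exact: sqrtr_ge0.
rewrite (le_lt_trans (enorm_le_norm _))//.
rewrite (@le_lt_trans _ _ ((n%:R + 1) * `|x1 - x2|))//.
  by rewrite ler_wpM2r// lerDl.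
by rewrite mulrC -ltr_pdivlMr.
Qed.

(* Setting the field to 0 on a null set of times and outside [0, T] makes it Borel in time and
   gives its growth, equicontinuity and cone conditions for all times. *)
Lemma classCF_modification (F : vec -> set vec) (T : R) (xbar : vec)
    (f : R -> vec -> vec) : classCF F T xbar f ->
  exists (g : R -> vec -> vec) (C r : R) (Z : set R),
    [/\ borel_in_time g, equicont_in_space g, linear_growth g C, 0 < r <= 1 &
     [/\ measurable Z, mu Z = 0%E,
      forall t, 0 <= t -> t <= T -> ~ Z t -> forall x, g t x = f t x &
      forall t x, `|x - xbar| <= r -> g t x = 0 \/ cone (F x) (g t x)]].
Proof.
move=> [fC [rho rho0 [Z0 [mZ0 Z00 Z0P]]]].
have [f_meas _ [c1 [c2 [c10 c20 fgrow]]]] := fC.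
have [q qd] := @vec_dense_seq R n.
(* These are the coordinates of [f] at the points of a dense sequence, so one null set serves them
   all; other points follow by equicontinuity. *)
pose u k : R -> R := if (unpickle k : option (nat * 'I_n)) is Some (j, i)
  then fun t => f t (q j) 0 i else fun=> 0.
have mT : measurable (`[0, T]%classic : set R) by exact: measurable_itv.
have mTZ : measurable (`[0, T] `\` Z0 : set R) by exact: measurableD.
have u_meas k : measurable_fun (`[0, T] `\` Z0 : set (lebesgueType R))
    (u k : lebesgueType R -> R).
  rewrite /u; case: unpickle => [[j i]|]; last exact: measurable_cst.
  apply: measurable_funS (f_meas (q j) i).
    by apply: sub_caratheodory; exact: measurable_itv.
  by move=> t [].
have [Z1 [mZ1 Z10 uZ1]] := borel_restriction mTZ u_meas.
pose D : set R := (`[0, T] `\` Z0) `\` Z1.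
pose g t x : vec := if t \in D then f t x else 0.
have DT t : t \in D -> 0 <= t <= T.
  by move=> /set_mem[[]]; rewrite /= in_itv.
have g_equi : equicont_in_space g.
  move=> r e e0; have [d d0 dP] := classC_equicont r fC e0.
  exists d => // t x1 x2 x1r x2r x12; rewrite /g; case: ifPn => tD.
    by apply: dP => //; exact: DT.
  by rewrite subrr normr0 ltW.
have n0 : 0 <= n%:R :> R by [].
have n1 : 0 < n%:R + 1 :> R by rewrite ltr_wpDl.
(* The radius places the sup-norm ball inside [eball xbar rho]. Its cap 1 later keeps nearest points
   within distance 1 of the nodes, as the Euler bounds demand. *)
exists g, (c1 + c2 * n%:R), (Num.min 1 (rho / (n%:R + 1))), (Z0 `|` Z1); split.
- move=> x i; have /choice[p pP] : forall N, exists k, `|x - q k| < mesh N.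
    by move=> N; apply: qd; exact: mesh_gt0.
  apply: (@measurable_fun_cvg _ _ _ _ (fun N t => g t (q (p N)) 0 i)).
    move=> N; have := uZ1 (pickle (p N, i)).
    rewrite /u pickleK; congr (measurable_fun _ _); apply/funext => t.
    by rewrite /g patchE; case: ifP => //; rewrite mxE.
  move=> t _; apply/cvgrPdist_le => e e0.
  have [d d0 dP] := g_equi (`|x| + 1) e e0.
  have d10 : 0 < Num.min d 1 by rewrite lt_min d0 ltr01.
  have := @mesh_cvg0 R => /cvgrPdist_lt/(_ _ d10).
  apply: filterS => N; rewrite sub0r normrN gtr0_norm ?mesh_gt0// lt_min => /andP[md m1].
  have xq := pP N.
  have := norm_coord (g t x - g t (q (p N))) i; rewrite !mxE => h.
  apply: le_trans h _; apply: dP; first by rewrite lerDl.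
    rewrite -[q (p N)](subKr x) (le_trans (ler_normB _ _))// lerD2l ltW//.
    exact: lt_trans xq m1.
  exact: lt_trans xq md.
- exact: g_equi.
- split; first by rewrite ltr_wpDr// mulr_ge0// ltW.
  move=> t x; rewrite /g; case: ifPn => tD; last first.
    by rewrite normr0 mulr_ge0// ?addr_ge0// ?mulr_ge0// ltW.
  have := fgrow t x; rewrite in_itv /= DT// => /(_ isT) h.
  rewrite (le_trans (norm_le_enorm _))// (le_trans h)//.
  have c2n : c2 * enorm x <= c2 * (n%:R * `|x|) by rewrite ler_pM2l// enorm_le_norm.
  have h1 : 0 <= c1 * `|x| by rewrite mulr_ge0// ltW.
  have h2 : 0 <= c2 * n%:R by rewrite mulr_ge0// ltW.
  lra.
- by rewrite lt_min ltr01 divr_gt0//= ge_min lexx.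
- split.
  + exact: measurableU.
  + by apply/eqP; rewrite -measure_le0 (le_trans (measureU2 _ mZ0 mZ1))//= ?Z00 ?Z10 ?adde0.
  + move=> t t0 tT nZ x; rewrite /g mem_set//; split; last by move=> z1; apply: nZ; right.
    by split; [rewrite /= in_itv /= t0|move=> z0; apply: nZ; left].
  + move=> t x xr; rewrite /g; case: ifPn => tD; last by left.
    right; have [[tT nZ0] _] := set_mem tD.
    have := Z0P t; have [//|nP /(_ nP)//] := pselect
      (t \in `[0, T] -> forall x, eball xbar rho x -> cone (F x) (f t x)).
    move=> h _; apply: h => //; rewrite /eball /= (le_trans (enorm_le_norm _))//.
    rewrite (@le_trans _ _ ((n%:R + 1) * `|x - xbar|))//.
      by rewrite ler_wpM2r// lerDl.
    rewrite mulrC -ler_pdivlMr// (le_trans xr)// ge_min lexx orbT//.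
Qed.

End borel_modification.

(** * Polygons aimed at nearest points *)

Section proximal_aiming.
Context {R : realType} {n : nat}.
Notation vec := 'rV[R]_n.
Variables (S : set vec) (xbar : vec) (g : R -> vec -> vec) (C r tau : R).
Hypothesis S_closed : closed S.
Hypothesis S_xbar : S xbar.
Hypothesis g_meas : borel_in_time g.
Hypothesis g_equi : equicont_in_space g.
Hypothesis g_growth : linear_growth g C.
Hypothesis r01 : 0 < r <= 1.
Hypothesis g_inward : forall t x z, S x -> `|x - xbar| <= r ->
  proximal_normal S x z -> dot z (g t x) <= 0.

(** A speed bound within distance [r] of [xbar]. Up to time [tau] the nodes move by at most
    [M * tau] and their nearest points by [n%:R + 1] times as much, so these stay where [g_inward]
    applies. *)
Let M : R := C * (1 + (`|xbar| + r)).
Hypothesis tau0 : 0 < tau.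
Hypothesis tau_small : M * tau * (n%:R + 1) <= r.

Let M0 : 0 < M.
Proof.
have /andP[r0 _] := r01; rewrite mulr_gt0 ?g_growth.1//.
by rewrite ltr_pwDl// addr_ge0// ltW.
Qed.

Let n1 : 0 < n%:R + 1 :> R. Proof. by rewrite ltr_wpDl. Qed.

Lemma aim_exists : exists P : vec -> vec, forall x, S (P x) /\
  forall s', S s' -> dot (x - P x) (x - P x) <= dot (x - s') (x - s').
Proof.
suff H x : exists s, S s /\ forall s', S s' -> dot (x - s) (x - s) <= dot (x - s') (x - s').
  by have [P PP] := choice H; exists P.
by have [s Ss smin] := projection_exists x S_closed S_xbar; exists s.
Qed.

Let P := sval (cid aim_exists).

Let PS x : S (P x). Proof. by rewrite /P; case: cid => Q /= /(_ x)[]. Qed.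

Let Pmin x s' : S s' -> dot (x - P x) (x - P x) <= dot (x - s') (x - s').
Proof. by rewrite /P; case: cid => Q /= /(_ x)[_]; exact. Qed.

(* Aiming at [S] stops at time [tau]; the polygons go on with the plain Euler scheme, because
   the uniqueness in (U) only applies to solutions on the whole of [0, T]. *)
Let aim N i x := if grid_pt N i <= tau then P x else x.

Let node N := fix node i : vec := if i is j.+1 then
  node j + vint (fun t => g t (aim N j (node j))) (grid_pt N j) (grid_pt N j.+1) else xbar.

Let P_dist x : `|P x - x| <= n%:R * `|x - xbar|.
Proof.
rewrite (le_trans (norm_le_enorm _))// (le_trans _ (enorm_le_norm _))//.
have -> : enorm (P x - x) = enorm (x - P x).
  by rewrite /enorm -opprB dotNl dotNr opprK.
by rewrite ler_wsqrtr// Pmin.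
Qed.

Let P_near x : `|P x - xbar| <= (n%:R + 1) * `|x - xbar|.
Proof.
rewrite -(subrKA x) (le_trans (ler_normD _ _))// mulrDl mul1r lerD2r.
exact: P_dist.
Qed.

Let speed N i (a b : R) : a <= b -> `|P (node N i) - xbar| <= r ->
  `|vint (fun t => g t (P (node N i))) a b| <= (b - a) * M.
Proof.
move=> ab Pr; apply: vint_norm => //; first exact: vec_lbm_cst g_meas g_growth _.
move=> t _; rewrite (le_trans (g_growth.2 _ _))// ler_pM2l ?g_growth.1// lerD2l.
by rewrite -[P _](subrK xbar) addrC (le_trans (ler_normD _ _))// lerD2l.
Qed.

Let node_P_near N i : `|node N i - xbar| <= M * grid_pt N i -> grid_pt N i <= tau ->
  `|P (node N i) - xbar| <= r.
Proof.
move=> h itau; rewrite (le_trans (P_near _))// (le_trans _ tau_small)// mulrC ler_pM2r//.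
by rewrite (le_trans h)// ler_pM2l.
Qed.

Let node_near N i : grid_pt N i <= tau -> `|node N i - xbar| <= M * grid_pt N i.
Proof.
elim: i => [|i IH] itau; first by rewrite subrr normr0 /grid_pt mul0r mulr0.
have itau' : grid_pt N i <= tau by apply: le_trans (grid_pt_le _ (leqnSn i)) itau.
rewrite /= /aim itau' addrAC (le_trans (ler_normD _ _))// grid_ptS mulrDr lerD ?IH//.
have := @speed N i (grid_pt N i) (grid_pt N i + mesh N) _ (node_P_near (IH itau') itau').
by rewrite addrAC subrr add0r mulrC lerDl; apply; exact/ltW/mesh_gt0.
Qed.

Let K : R := (n%:R * M) ^+ 2.

(** The old nearest point still competes at the new node. In the expanded square the cross term is
    nonpositive by [g_inward], and the increment contributes at most [mesh N ^+ 2 * K]. *)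
Let node_dist N i : grid_pt N i <= tau ->
  dot (node N i - P (node N i)) (node N i - P (node N i)) <= grid_pt N i * (mesh N * K).
Proof.
elim: i => [|i IH] itau.
  rewrite {1}/grid_pt mul0r mul0r (le_trans (Pmin _ S_xbar))//= subrr.
  by rewrite /dot big1// => j _; rewrite !mxE mul0r.
have itau' : grid_pt N i <= tau by apply: le_trans (grid_pt_le _ (leqnSn i)) itau.
have Pr := node_P_near (node_near itau') itau'.
apply: le_trans (Pmin _ (PS (node N i))) _.
set p := P (node N i) in Pr IH *.
set V := vint (fun t => g t p) (grid_pt N i) (grid_pt N i.+1).
have -> : node N i.+1 - p = (node N i - p) + V.
  by rewrite /= /aim itau' -/p addrAC.
have ii : grid_pt N i <= grid_pt N i.+1 :> R by exact: grid_pt_le.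
have zV : dot (node N i - p) V <= 0.
  rewrite -[leRHS](mulr0 (grid_pt N i.+1 - grid_pt N i)).
  apply: dot_vint_le => //; first exact: vec_lbm_cst g_meas g_growth _.
  move=> t _; apply: g_inward => //; first exact: PS.
  by apply: nearest_proximal => s' Ss'; exact: Pmin.
have VV : dot V V <= mesh N * (mesh N * K).
  rewrite -enorm_sqr (_ : mesh N * _ = (n%:R * (mesh N * M)) ^+ 2); last first.
    by rewrite /K; ring.
  have nM := mulr_ge0 (ler0n R n) (mulr_ge0 (ltW (@mesh_gt0 R N)) (ltW M0)).
  rewrite ler_pXn2r ?nnegrE ?sqrtr_ge0//.
  rewrite (le_trans (enorm_le_norm _))// ler_wpM2l//.
  have := @speed N i (grid_pt N i) (grid_pt N i.+1) ii Pr.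
  by rewrite {2}grid_ptS addrAC subrr add0r.
have := IH itau'; rewrite grid_ptS mulrDl.
have dd (u v : vec) : dot (u + v) (u + v) = dot u u + 2 * dot u v + dot v v.
  by rewrite dotDl !dotDr (dotC v u); ring.
rewrite (dd (node N i - p) V); lra.
Qed.

(** The root is the bound of [node_dist] at time [tau]; after [tau] the slope point is the node
    itself and the error is 0. *)
Let err N : R := Num.min 1 (Num.sqrt (tau * (mesh N * K))).

Let aim_near N i : `|aim N i (node N i) - node N i| <= err N.
Proof.
rewrite /aim; case: ifPn => itau; last first.
  by rewrite subrr normr0 le_min ler01 sqrtr_ge0.
rewrite le_min; apply/andP; split.
  rewrite (le_trans (P_dist _))// (@le_trans _ _ ((n%:R + 1) * (M * tau)))//.
    rewrite ler_pM// ?lerDl// (le_trans (node_near itau))// ler_pM2l//.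
  by rewrite mulrC (le_trans tau_small)//; case/andP: r01.
rewrite distrC (le_trans (norm_le_enorm _))// ler_wsqrtr//.
rewrite (le_trans (node_dist itau))// ler_wpM2r// mulr_ge0 ?sqr_ge0//.
exact/ltW/mesh_gt0.
Qed.

Let err_cvg : err N @[N --> \oo] --> (0 : R).
Proof.
apply/cvgrPdist_lt => d d0.
have K1 : 0 < tau * K + 1 by rewrite ltr_wpDl// mulr_ge0 ?(ltW tau0)// sqr_ge0.
have dK : 0 < d ^+ 2 / (tau * K + 1) by rewrite divr_gt0// exprn_gt0.
have := @mesh_cvg0 R => /cvgrPdist_lt/(_ _ dK).
apply: filterS => N; rewrite !sub0r !normrN gtr0_norm ?mesh_gt0// => mN.
rewrite ger0_norm; last by rewrite le_min ler01 sqrtr_ge0.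
rewrite /err gt_min; apply/orP; right.
rewrite -[ltRHS](gtr0_norm d0) -[ltRHS]sqrtr_sqr ltr_sqrt ?exprn_gt0//.
rewrite mulrCA (@le_lt_trans _ _ (mesh N * (tau * K + 1)))//.
  by rewrite ler_pM2l ?mesh_gt0// lerDl.
by rewrite -ltr_pdivlMr.
Qed.

Lemma viable_solution : exists y : R -> vec,
  [/\ vec_lbm (fun t => g t (y t)),
      (forall b, exists K : R, forall t, `|t| <= b -> `|g t (y t)| <= K),
      (forall t, 0 <= t -> y t = xbar + vint (fun t => g t (y t)) 0 t) &
      S (y tau)].
Proof.
have err1 N : err N <= 1 by rewrite ge_min lexx.
have [y [_ y1 y2 y3 y4]] := @euler_limit R n g C g_meas g_equi g_growth
  xbar node (fun N i => aim N i (node N i)) err (fun=> erefl) (fun _ _ => erefl)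
  aim_near err_cvg err1.
exists y; split => //.
(* The nearest points to the last nodes before [tau] lie in [S] and approach [y tau]. *)
rewrite [S](closure_id S).1// => B /nbhs_ballP[d /= d0 dB].
have d20 : 0 < d / 2 by lra.
have [N0 _ N0P] : \forall N \near \oo, err N < d / 2.
  move: err_cvg => /cvgrPdist_lt/(_ _ d20); apply: filterS => N.
  by rewrite sub0r normrN; apply: le_lt_trans; exact: ler_norm.
have [N N0N yN] := y4 tau (d / 2) N0 (ltW tau0) d20.
have /andP[itau _] := @grid_index_itv R N tau (ltW tau0).
have := aim_near N (grid_index N tau); rewrite /aim itau => Pnear.
exists (P (node N (grid_index N tau))); split; first exact: PS.
apply: dB; rewrite -ball_normE /= -(subrKA (node N (grid_index N tau))).
rewrite (le_lt_trans (ler_normD _ _))//.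
have := N0P N N0N => /= h; rewrite distrC in Pnear; lra.
Qed.

End proximal_aiming.

Section strong_invariance.
Context {R : realType} {n : nat}.
Notation mu := (@lebesgue_measure R).
Notation vec := 'rV[R]_n.
Variables (F : vec -> set vec) (S : set vec).
Hypothesis S_closed : closed S.
Hypothesis F_inward : forall x p v, S x -> proximal_normal S x p -> F x v -> dot p v <= 0.

(** A single later time in [S] is enough, since this is applied at the last such time. *)
Lemma invariance_step (T : R) (xbar : vec) (phi : R -> vec) (f : R -> vec -> vec) :
  0 < T -> S xbar -> classCF F T xbar f -> unique_ivp_solution f T xbar phi ->
  exists2 t, 0 < t <= T & S (phi t).
Proof.
move=> T0 Sx fCF [_ phi_unique].
have [g [C [r [Z [g1 g2 g3 r01 [mZ Z0 gf gcone]]]]]] := classCF_modification fCF.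
have /andP[r0 r1] := r01.
set M : R := C * (1 + (`|xbar| + r)).
have M0 : 0 < M by rewrite mulr_gt0 ?g3.1// ltr_pwDl// addr_ge0// ltW.
have n1 : 0 < n%:R + 1 :> R by rewrite ltr_wpDl.
pose tau : R := Num.min T (r / (M * (n%:R + 1))).
have tau0 : 0 < tau by rewrite lt_min T0 divr_gt0// mulr_gt0.
have tau_small : M * tau * (n%:R + 1) <= r.
  have Mn := mulr_gt0 M0 n1.
  by rewrite mulrAC mulrC -ler_pdivlMr// /tau ge_min lexx orbT.
(* Times at which the field was set to 0 are harmless; at all others the value is a nonnegative
   multiple of some [v] in [F x]. *)
have inward t x z : S x -> `|x - xbar| <= r -> proximal_normal S x z -> dot z (g t x) <= 0.
  move=> Sx' xr zN; have [->|[eta eta0 [v Fv ->]]] := gcone t x xr.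
    by rewrite /dot big1// => i _; rewrite mxE mulr0.
  by rewrite dotZr mulr_ge0_le0//; exact: F_inward Fv.
have [y [y1 y2 y3 Sy]] := viable_solution S_closed Sx g1 g2 g3 r01 inward tau0 tau_small.
have ysol : ivp_solution f T xbar y by exact: integral_ivp_solution mZ Z0 gf y1 y2 y3.
have tauT : tau <= T by rewrite ge_min lexx.
exists tau; first by rewrite tau0 tauT.
by rewrite -(phi_unique y ysol)// in_itv /= ltW.
Qed.

Lemma strong_invariance_sufficient : conditionU F -> strongly_invariant F S.
Proof.
move=> F_U x0 Sx0 T x [T0 x_ac x_init x_ae _] t t0 tT.
apply: contrapT => nSt.
pose A := [set s : R | 0 <= s <= t /\ S (x s)].
have A0 : A 0 by split; rewrite ?lexx ?t0// x_init.
have supA : has_sup A by split; [exists 0|exists t => s [/andP[]]].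
(* Only times up to the fixed [t] count, so earlier exits and returns do not matter; [c] is attained
   because [S] is closed and [x] continuous. *)
set c := sup A.
have c0 : 0 <= c by exact: sup_upper_bound.
have ct : c <= t by apply: sup_le_ub => [|s [/andP[]]//]; exists 0.
have ac0t : absolutely_continuous 0 t x by exact: x_ac.
have Sc : S (x c).
  rewrite [S](closure_id S).1// => B /nbhs_ballP[e /= e0 eB].
  have [d d0 dP] := absolutely_continuous_modulus ac0t e0.
  have [s As cs] := sup_adherent d0 supA.
  have sc : s <= c by exact: sup_upper_bound.
  have [/andP[s0 st] Ss] := As.
  exists (x s); split => //; apply: eB; rewrite -ball_normE /=.
  by apply: dP => //; rewrite /c in sc *; lra.
have ct' : c < t.
  by rewrite lt_neqAle ct andbT; apply/eqP => ctE; apply: nSt; rewrite -ctE.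
have traj : trajectory F (t - c) (x c) (fun s => x (s + c)).
  split; last 2 first.
  - by rewrite add0r.
  - have := ae_shift c x_ae; apply: (@filterS _ _ (ae_filter_ringOfSetsType mu)) => s sP.
    rewrite in_itv /= => /andP[s0 st].
    have [||ds Fs] := sP.
    + by rewrite addr_ge0.
    + by apply: le_lt_trans tT; rewrite lee_fin; lra.
    + by have [d1 d2] := derivable_shift ds; rewrite d2; split.
  - apply: absolutely_continuous_shift; rewrite add0r subrK.
    exact: x_ac.
have T1 : 0 < t - c by rewrite subr_gt0.
have [f fCF funique] := F_U (x c) (t - c) (ltW T1) _ traj.
have [s /andP[s0 sT] Ss] := invariance_step T1 Sc fCF funique.
have : s + c <= c.
  by apply: sup_upper_bound => //; split => //; apply/andP; split; lra.
lra.
Qed.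

End strong_invariance.

(** * Maximal trajectories through a time change, and the necessity part *)

Section selection_through_point.
Context {R : realType} {n : nat}.
Notation vec := 'rV[R]_n.

(* [F] stays lower semicontinuous when its value at [xbar] is replaced by {v}. *)
Lemma selection_through (F : vec -> set vec) (xbar v : vec) : multi_lsc F ->
  (forall x, convex_set (F x)) -> (forall x, closed (F x)) -> (forall x, F x !=set0) ->
  F xbar v -> exists g : vec -> vec,
    [/\ continuous g, (forall x, F x (g x)) & g xbar = v].
Proof.
move=> F_lsc F_convex F_closed F0 Fv.
pose G x : set vec := if x == xbar then [set v] else F x.
have [|x|x|x|g cg gG] := @michael_selection R n G.
- move=> O oO; have [Ov|nOv] := pselect (O v).
    rewrite (_ : [set _ | _] = [set x | F x `&` O !=set0]); first exact: F_lsc.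
    apply/seteqP; split => x; rewrite /G /=; case: eqP => [->|//] _; first by exists v.
    by exists v.
  (* If [O] misses [v], the only effect is to remove the point [xbar], which leaves the set open. *)
  rewrite (_ : [set _ | _] = [set x | F x `&` O !=set0] `&` ~` [set xbar]); last first.
    apply/seteqP; split => x; rewrite /G /=; case: eqP => [->|//].
    + by move=> [w [-> Ow]].
    + by move=> [_].
    + by move=> nx [].
  apply: openI; first exact: F_lsc.
  exact/closed_openC/accessible_closed_set1/hausdorff_accessible/norm_hausdorff.
- rewrite /G; case: ifP => _; last exact: F_convex.
  move=> u w t /set_mem -> /set_mem ->; apply/mem_set => /=.
  suff : t%:num *: v + (1 - t%:num) *: v = v by [].
  by rewrite -scalerDl addrC subrK scale1r.
- rewrite /G; case: ifP => _; last exact: F_closed.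
  exact/accessible_closed_set1/hausdorff_accessible/norm_hausdorff.
- by rewrite /G; case: ifP => _; [exists v|exact: F0].
exists g; split => //; last by have := gG xbar; rewrite /G eqxx.
by move=> x; have := gG x; rewrite /G; case: eqP => [-> ->|].
Qed.

End selection_through_point.

Section autonomous.
Context {R : realType} {n : nat}.
Notation vec := 'rV[R]_n.

Lemma continuous_along (U : topologicalType) (z : R -> vec) (k : vec -> U) :
  continuous z -> continuous k -> continuous (fun t => k (z t)).
Proof.
move=> cz ck t; apply: (@cvg_comp _ _ _ z k (nbhs t) (nbhs (z t)) (nbhs (k (z t)))).
  exact: cz.
exact: ck.
Qed.

Lemma continuous_unif_ball (h : vec -> vec) (r e : R) : continuous h -> 0 < e ->
  exists2 d : R, 0 < d & forall x1 x2 : vec, `|x1| <= r -> `|x2| <= r ->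
    `|x1 - x2| < d -> `|h x1 - h x2| <= e.
Proof.
move=> ch e0; have := @closed_ball_compact R n 0 r.
move/compact_near_coveringP.
move=> /(_ R (0 : R)^'+ (fun d x => forall x' : vec, `|x - x'| < d -> `|h x - h x'| <= e) _).
have cover x : [set y : vec | `|0 - y| <= r] x -> \forall x' \near x & d \near (0 : R)^'+,
    forall x'' : vec, `|x' - x''| < d -> `|h x' - h x''| <= e.
  move=> _; have e20 : 0 < e / 2 by lra.
  have := ch x => /(@cvgrPdist_lt _ _ _ (nbhs x))/(_ _ e20)/nbhs_ballP[d /= d0 dP].
  have d20 : 0 < d / 2 by lra.
  exists (ball x (d / 2), [set y : R | y < d / 2]).
    split; first by apply/nbhs_ballP; exists (d / 2).
    by near=> y; near: y; exact: nbhs_right_lt.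
  move=> [x' y] /= [+ yd] x'' x'x''; rewrite -ball_normE /= => xx'.
  have h1 : `|h x - h x'| < e / 2.
    by apply: dP; rewrite -ball_normE /=; lra.
  have h2 : `|h x - h x''| < e / 2.
    apply: dP; rewrite -ball_normE /= -(subrKA x') (le_lt_trans (ler_normD _ _))//; lra.
  rewrite -(subrKA (h x)) (le_trans (ler_normD _ _))// distrC; lra.
move=> /(_ cover) H.
have [d [d0 dP]] : exists d : R, 0 < d /\ [set y : vec | `|0 - y| <= r] `<=`
    (fun x => forall x' : vec, `|x - x'| < d -> `|h x - h x'| <= e).
  near (0 : R)^'+ => d; exists d; split; first by near: d; exact: nbhs_right_gt.
  by near: d; exact: H.
by exists d => // x1 x2 x1r _; apply: dP; rewrite /= sub0r normrN.
Unshelve. all: by end_near. Qed.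

(** Peano's theorem, as the case of the Euler limit in which slopes are taken at the nodes with zero
    error. *)
Lemma bounded_autonomous_solution (h : vec -> vec) (x0 : vec) : continuous h ->
  (forall x, `|h x| <= 1) -> exists z : R -> vec,
    [/\ continuous z, vec_lbm (fun t => h (z t)) &
      forall t, 0 <= t -> z t = x0 + vint (fun t => h (z t)) 0 t].
Proof.
move=> ch h1; pose f (t : R) := h.
have f1 : borel_in_time f by move=> x i; exact: measurable_cst.
have f2 : equicont_in_space f.
  move=> r e e0; have [d d0 dP] := continuous_unif_ball r ch e0.
  by exists d => // _; exact: dP.
have f3 : linear_growth f 1.
  by split => // t x; rewrite mul1r (le_trans (h1 x))// lerDl.
pose x (N : nat) := fix x i : vec := if i is j.+1 then
  x j + vint (fun t => f t (x j)) (grid_pt N j) (grid_pt N j.+1) else x0.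
have near0 N i : `|x N i - x N i| <= (fun=> 0 : R) N by rewrite subrr normr0.
have [z [z1 z2 _ z3 _]] := @euler_limit R n f 1 f1 f2 f3 x0 x x (fun=> 0)
  (fun=> erefl) (fun _ _ => erefl) near0 (@cvg_cst _ _ _ _ _) (fun=> ler01).
by exists z.
Qed.

End autonomous.

(** * Reparametrisation of a bounded field *)

Section time_change.
Context {R : realType} {n : nat}.
Notation mu := (@lebesgue_measure R).
Notation vec := 'rV[R]_n.
Variables (g : vec -> vec) (x0 : vec).
Hypothesis g_continuous : continuous g.

(** The rate of true time per unit of the parameter of [z]: dividing the velocity [w x *: g x] by it
    restores [g x]. *)
Let w x : R := (1 + `|g x|)^-1.

Let w_den x : 0 < 1 + `|g x|. Proof. by rewrite ltr_pwDl. Qed.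

Let w_gt0 x : 0 < w x. Proof. by rewrite invr_gt0. Qed.

Let w_le1 x : w x <= 1. Proof. by rewrite invf_le1// lerDl. Qed.

Let w_continuous : continuous w.
Proof.
move=> x; apply: (@cvgV _ _ (nbhs x)); first by rewrite gt_eqF.
apply: (@cvgD _ _ _ (nbhs x)); first exact: cvg_cst.
apply: (@cvg_norm _ _ _ (nbhs x)); exact: g_continuous.
Qed.

Let h x : vec := w x *: g x.

Let h_continuous : continuous h.
Proof.
by move=> x; apply: (@cvgZ _ _ _ (nbhs x)); [exact: w_continuous|exact: g_continuous].
Qed.

Let h_le1 x : `|h x| <= 1.
Proof.
rewrite /h normrZ gtr0_norm// mulrC ler_pdivrMr// mul1r lerDr//.
Qed.

Section solution.
Variable z : R -> vec.
Hypothesis z_continuous : continuous z.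
Hypothesis hz_lbm : vec_lbm (fun t => h (z t)).
Hypothesis z_integral : forall t, 0 <= t -> z t = x0 + vint (fun t => h (z t)) 0 t.

Let wz t := w (z t).

Let wz_continuous : continuous wz.
Proof. exact: (continuous_along z_continuous w_continuous). Qed.

Let wz_lbm : loc_bounded_measurable wz.
Proof.
split; first exact: continuous_measurable_fun.
move=> b; exists 1 => t _; rewrite gtr0_norm; [exact: w_le1|exact: w_gt0].
Qed.

Let z_lip s t : 0 <= s -> s <= t -> `|z t - z s| <= t - s.
Proof.
move=> s0 st; have := @integral_lipschitz R n x0 (fun t => h (z t)) z t 1 hz_lbm
  (fun t _ => h_le1 (z t)) z_integral s t s0 st (lexx t).
by rewrite mul1r.
Qed.

(* The solution [z] of [z' = h z] visits [z s] at the true time [theta s]. *)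
Let theta (s : R) : R := \int[mu]_(t in `[0, s]) wz t.

Let theta_incr s t : 0 <= s -> s <= t -> theta t - theta s = \int[mu]_(r in `[s, t]) wz r.
Proof. by move=> s0 st; rewrite /theta (Rintegral_split wz_lbm s0 st) addrAC subrr add0r. Qed.

Let theta_ge s t m : 0 <= s -> s <= t -> (forall r, s <= r <= t -> m <= wz r) ->
  m * (t - s) <= theta t - theta s.
Proof.
move=> s0 st mw; rewrite theta_incr// -[leRHS]opprK lerNr.
have := @Rintegral_le_bound R (\- wz) s t (- m) (lbmN wz_lbm) st _.
rewrite (_ : Rintegral _ _ _ = - \int[mu]_(r in `[s, t]) wz r); last first.
  rewrite -mulN1r -RintegralZl//; last exact: lbm_integrable.
  by apply: eq_Rintegral => r _; rewrite mulN1r.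
rewrite mulrN mulrC; apply => r rst; rewrite lerN2; exact: mw.
Qed.

Let theta0 : theta 0 = 0.
Proof. by rewrite /theta set_itv1 Rintegral_set1. Qed.

Let w_min s : 0 <= s -> exists2 m : R, 0 < m & forall r, 0 <= r <= s -> m <= wz r.
Proof.
move=> s0; have cw : {within `[0, s], continuous wz} by exact: continuous_subspaceT.
have [c _ cmin] := @EVT_min R wz 0 s s0 cw.
by exists (wz c); [exact: w_gt0|move=> r rs; apply: cmin; rewrite in_itv].
Qed.

Let theta_lt s t : 0 <= s -> s < t -> theta s < theta t.
Proof.
move=> s0 st; have [m m0 mP] := w_min (le_trans s0 (ltW st)).
rewrite -subr_gt0 (@lt_le_trans _ _ (m * (t - s)))//.
  by rewrite mulr_gt0// subr_gt0.
apply: theta_ge => //; first exact: ltW.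
by move=> r /andP[sr rt]; apply: mP; rewrite rt andbT (le_trans s0).
Qed.

Let theta_ge0 s : 0 <= s -> 0 <= theta s.
Proof.
rewrite le_eqVlt => /predU1P[<-|s0]; first by rewrite theta0.
by rewrite -theta0 ltW// theta_lt.
Qed.

(** The total true time along [z]; it is finite if [g] grows so fast along [z] that the clock rate
    is integrable. *)
Let T : \bar R := ereal_sup [set (theta s)%:E | s in [set s : R | 0 <= s]].

Let theta_ltT s : 0 <= s -> ((theta s)%:E < T)%E.
Proof.
move=> s0; have s1 : s < s + 1 by rewrite ltrDl.
apply: (@lt_le_trans _ _ (theta (s + 1))%:E); first by rewrite lte_fin theta_lt.
by apply: ereal_sup_ubound; exists (s + 1) => //=; rewrite addr_ge0.
Qed.

Let theta_onto t : 0 <= t -> (t%:E < T)%E -> exists s, 0 <= s /\ theta s = t.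
Proof.
move=> t0 tT; have [_ [s /= s0 <-]] := ereal_sup_gt tT; rewrite lte_fin => ts.
have ct : {within `[0, s], continuous theta}.
  exact: (parameterized_integral_continuous s0 (lbm_integrable 0 s wz_lbm)).
have [|c] := @IVT R theta 0 s t s0 ct.
  have h0 := theta_ge0 s0.
  by rewrite theta0 min_l// max_r// t0 ltW.
by rewrite in_itv /= => /andP[c0 _] ct'; exists c.
Qed.

Let sigma (t : R) : R :=
  if pselect (0 <= t /\ (t%:E < T)%E) is left p then sval (cid (theta_onto p.1 p.2)) else 0.

Let sigmaP t : 0 <= t -> (t%:E < T)%E -> 0 <= sigma t /\ theta (sigma t) = t.
Proof.
move=> t0 tT; rewrite /sigma; case: pselect => [p|/not_andP[]//].
by case: cid.
Qed.

Let sigma_theta s : 0 <= s -> sigma (theta s) = s.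
Proof.
move=> s0; have [u0 ut] := sigmaP (theta_ge0 s0) (theta_ltT s0).
have [su|us|//] := ltgtP s (sigma (theta s)).
  by have := theta_lt s0 su; rewrite ut ltxx.
by have := theta_lt u0 us; rewrite ut ltxx.
Qed.

Let sigma_le s t : 0 <= s -> s <= t -> (t%:E < T)%E -> sigma s <= sigma t.
Proof.
move=> s0 st tT; have sT : (s%:E < T)%E by apply: le_lt_trans tT; rewrite lee_fin.
have [a0 aE] := sigmaP s0 sT; have [b0 bE] := sigmaP (le_trans s0 st) tT.
rewrite leNgt; apply/negP => /(theta_lt b0); rewrite aE bE.
by rewrite ltNge st.
Qed.

(** Up to the parameter [sigma b] the clock rate has a positive minimum [m], so the inverse clock is
    Lipschitz with constant [m^-1]. *)
Let sigma_lip b : 0 <= b -> (b%:E < T)%E -> exists2 K : R, 0 < K &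
  forall s t, 0 <= s -> s <= t -> t <= b -> sigma t - sigma s <= K * (t - s).
Proof.
move=> b0 bT; have [sb0 _] := sigmaP b0 bT; have [m m0 mP] := w_min sb0.
exists m^-1 => [|s t s0 st tb]; first by rewrite invr_gt0.
have tT : (t%:E < T)%E by apply: le_lt_trans bT; rewrite lee_fin.
have sT : (s%:E < T)%E by apply: le_lt_trans tT; rewrite lee_fin.
have [a0 aE] := sigmaP s0 sT; have [c0 cE] := sigmaP (le_trans s0 st) tT.
rewrite mulrC ler_pdivlMr// -{2}aE -{2}cE mulrC.
apply: theta_ge => //; first exact: sigma_le.
move=> r /andP[r1 r2]; apply: mP; rewrite (le_trans a0)//= (le_trans r2)//.
by apply: sigma_le => //; exact: le_trans st.
Qed.

Let x t := z (sigma t).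

Let x_ac a b : 0 <= a -> a <= b -> (b%:E < T)%E -> absolutely_continuous a b x.
Proof.
move=> a0 ab bT; have [K K0 KP] := sigma_lip (le_trans a0 ab) bT.
apply: (@lipschitz_absolutely_continuous _ _ _ _ K) => s t as_ st tb.
have s0 : 0 <= s by exact: le_trans as_.
have tT : (t%:E < T)%E by apply: le_lt_trans bT; rewrite lee_fin.
have sT : (s%:E < T)%E by apply: le_lt_trans tT; rewrite lee_fin.
rewrite (le_trans (z_lip _ _))//; [by have [] := sigmaP s0 sT|exact: sigma_le|exact: KP].
Qed.

Let x_derive t : 0 < t -> (t%:E < T)%E ->
  derivable x t 1 /\ x^`()%classic t = g (x t).
Proof.
move=> t0 tT; have [s0 sE] := sigmaP (ltW t0) tT; set s := sigma t in s0 sE.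
have {}s0 : 0 < s.
  by rewrite lt_neqAle s0 andbT; apply/eqP => s00; move: t0; rewrite -sE -s00 theta0 ltxx.
(* Some time beyond [t] is needed so that one Lipschitz constant covers increments of both signs. *)
pose b := theta (s + 1).
have tb : t < b by rewrite -sE; apply: theta_lt; [exact: ltW|rewrite ltrDl].
have bT : (b%:E < T)%E by apply: theta_ltT; rewrite addr_ge0// ltW.
have b0 : 0 <= b by apply: ltW; exact: lt_trans tb.
have [K K0 KP] := sigma_lip b0 bT.
(* The parameter increment belonging to the increment [e] of true time. The difference quotient of
   [x] at [e] is that of [z] at [kappa e] divided by that of [theta], so [kappa e] must tend to 0
   without vanishing. *)
pose kappa e : R := sigma (e + t) - s.
pose r := Num.min t (b - t).
have r0 : 0 < r by rewrite lt_min t0 subr_gt0.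
have etb e : `|e| < r -> 0 <= e + t <= b.
  by rewrite lt_min !ltr_norml => /andP[/andP[h1 h2] /andP[h3 h4]]; apply/andP; split; lra.
have theta_kappa e : `|e| < r -> theta (kappa e + s) = e + t.
  move=> /etb/andP[h1 h2]; rewrite /kappa subrK.
  by have [] := sigmaP h1 (le_lt_trans (_ : (e + t)%:E <= b%:E)%E bT).
have kappa_neq0 e : `|e| < r -> e != 0 -> kappa e != 0.
  move=> /theta_kappa ke en0; apply/eqP => k0; move: ke; rewrite k0 add0r sE => te.
  by move/eqP : en0; apply; lra.
have kappa_le e : `|e| < r -> `|kappa e| <= K * `|e|.
  move=> /etb/andP[h1 h2]; rewrite /kappa /s; have [e0|e0] := leP 0 e.
    have te : t <= e + t by rewrite lerDr.
    rewrite !ger0_norm ?subr_ge0//.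
      by have := KP t (e + t) (ltW t0) te h2; rewrite addrK.
    by apply: sigma_le => //; [exact: ltW|exact: le_lt_trans bT].
  have te : e + t <= t by rewrite gerDr ltW.
  rewrite (ltr0_norm e0) distrC ger0_norm ?subr_ge0; last exact: sigma_le.
  by have := KP (e + t) t h1 te (ltW tb); rewrite opprD addrCA subrr addr0.
have kappa_cvg : kappa e @[e --> 0^'] --> (0 : R)^'.
  move=> V /nbhs_ballP[d /= d0 dV]; apply/nbhs_ballP.
  have dK : 0 < d / K by rewrite divr_gt0.
  exists (Num.min r (d / K)); first by rewrite /= lt_min r0.
  move=> e; rewrite -ball_normE /= sub0r normrN lt_min => /andP[er ed] en0.
  apply: dV; last exact: kappa_neq0.
  rewrite -ball_normE /= sub0r normrN (le_lt_trans (kappa_le e er))//.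
  by rewrite mulrC -ltr_pdivlMr.
have hz_continuous : continuous (fun t => h (z t)).
  exact: continuous_along z_continuous h_continuous.
have dz : k^-1 *: (z (k + s) - z s) @[k --> 0^'] --> h (z s).
  apply/derive1_cvgP.
  apply: derive_near_eq (continuous_derive_vint x0 hz_lbm s0 (hz_continuous s)).
  near=> q; rewrite z_integral//; apply: ltW; near: q; exact: lt_nbhsr.
have dtheta : k^-1 *: (theta (k + s) - theta s) @[k --> 0^'] --> wz s.
  exact: (continuous_derive_integral wz_lbm s0 (@wz_continuous s)).
have dQ : (k^-1 *: (theta (k + s) - theta s))^-1 *: (k^-1 *: (z (k + s) - z s))
    @[k --> 0^'] --> g (z s).
  have -> : g (z s) = (wz s)^-1 *: h (z s).
    by rewrite /h scalerA mulVf ?scale1r// gt_eqF// w_gt0.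
  by apply: cvgZ => //; apply: cvgV => //; rewrite gt_eqF// w_gt0.
apply/derive1_cvgP.
have := cvg_comp _ _ kappa_cvg dQ.
apply: cvg_trans; apply: near_eq_cvg.
have rn : \forall e \near (0 : R)^', `|e| < r.
  apply/nbhs_ballP; exists r => //= e; rewrite -ball_normE /= sub0r normrN//.
near=> e.
have er : `|e| < r by near: e; exact: rn.
have en0 : e != 0 by near: e; exact: nbhs_dnbhs_neq.
have kn0 := kappa_neq0 e er en0.
rewrite /= theta_kappa// sE addrK [_ *: e]/(_ * _) invfM invrK scalerA.
rewrite mulrAC mulfV// mul1r /kappa subrK//.
Unshelve. all: by end_near. Qed.

(* A unit of the time of [z] that starts in the ball of radius [A] takes at least [m] units of
   true time, which is impossible once the true time is within [m] of its supremum [r]. *)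
Let x_escape r : T = r%:E -> enorm (x t) @[t --> r^'-] --> +oo.
Proof.
move=> Tr; apply/cvgryPgt => A.
have [m m0 mP] : exists2 m : R, 0 < m & forall y : vec, `|y| <= A + 1 -> m <= w y.
  have [A1|A1] := ltP (A + 1) 0.
    exists 1 => // y yA; have := le_lt_trans yA A1; by rewrite ltNge normr_ge0.
  have [|||c _ cP] := @compact_EVT_min vec R w [set y : vec | `|0 - y| <= A + 1].
  - by exists 0; rewrite /= subrr normr0.
  - exact: closed_ball_compact.
  - exact: continuous_subspaceT.
  exists (w c) => // y yA; apply: cP; apply/mem_set.
  by rewrite /= sub0r normrN.
have [_ [s0 /= s00 <-]] : exists2 y,
    [set (theta s)%:E | s in [set s : R | 0 <= s]] y & ((r - m)%:E < y)%E.
  by apply: ereal_sup_gt; rewrite -/T Tr lte_fin; lra.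
rewrite lte_fin => s0r.
have s0T : theta s0 < r by have := theta_ltT s00; rewrite Tr lte_fin.
have far s : s0 <= s -> A < `|z s|.
  move=> s0s; rewrite ltNge; apply/negP => zA.
  have ss0 : 0 <= s by exact: le_trans s0s.
  have s1 : s <= s + 1 by rewrite lerDl.
  have : m * ((s + 1) - s) <= theta (s + 1) - theta s.
    apply: theta_ge => // q /andP[sq q1]; apply: mP.
    rewrite -[z q](subrK (z s)) (le_trans (ler_normD _ _))// addrC lerD//.
    by rewrite (le_trans (z_lip ss0 sq))//; lra.
  have : theta (s + 1) < r.
    by rewrite -lte_fin -Tr; apply: theta_ltT; exact: le_trans s1.
  have : theta s0 <= theta s.
    by move: s0s; rewrite le_eqVlt => /predU1P[->//|s0s]; exact/ltW/theta_lt.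
  rewrite (addrC s 1) addrK mulr1; lra.
have : \forall t \near r^'-, theta s0 < t /\ t < r.
  near=> t; split; last by near: t; exact: nbhs_left_lt.
  by near: t; exact: nbhs_left_gt.
apply: filterS => t [s0t tr].
have t0 : 0 <= t by rewrite (le_trans (theta_ge0 s00))// ltW.
have tT : (t%:E < T)%E by rewrite Tr lte_fin.
apply: lt_le_trans (norm_le_enorm _); apply: far.
by rewrite -(sigma_theta s00); apply: sigma_le => //; [exact: theta_ge0|exact: ltW].
Unshelve. all: by end_near. Qed.

Lemma time_changed_trajectory (F : vec -> set vec) : (forall x, F x (g x)) ->
  exists (T : \bar R) (x : R -> vec), maximal_trajectory F x0 T x /\
    forall s, 0 <= s -> exists2 t, 0 <= t /\ (t%:E < T)%E & x t = z s.
Proof.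
move=> gF; exists T, x; split; last first.
  move=> s s0; exists (theta s); first by split; [exact: theta_ge0|exact: theta_ltT].
  by rewrite /x sigma_theta.
split.
- by have := theta_ltT (lexx 0); rewrite theta0.
- exact: x_ac.
- have := sigma_theta (lexx 0); rewrite theta0 /x => ->.
  by rewrite z_integral// vintxx addr0.
- have ae0 : {ae mu, forall t : R, t != 0}.
    exists [set 0]; split; [exact: measurable_set1|exact: lebesgue_measure_set1|].
    by move=> t /= /negP; rewrite negbK => /eqP.
  apply: (@filterS _ _ (ae_filter_ringOfSetsType mu)) ae0 => t tn0 t0 tT.
  have tp : 0 < t by rewrite lt_neqAle eq_sym tn0.
  by have [d1 ->] := x_derive tp tT; split.
- have : (0 < T)%E by have := theta_ltT (lexx 0); rewrite theta0.
  case E : T => [r| |]//; last by left.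
  by right; exists r => //; exact: x_escape.
Qed.

End solution.

(* [z] runs through the trajectory [x] with speed at most 1. *)
Lemma exists_maximal_trajectory (F : vec -> set vec) : (forall x, F x (g x)) ->
  exists (T : \bar R) (x z : R -> vec) (h : vec -> vec),
  [/\ maximal_trajectory F x0 T x,
      forall s, 0 <= s -> exists2 t, 0 <= t /\ (t%:E < T)%E & x t = z s,
      forall s, 0 <= s -> `|z s - x0| <= s &
      exists c : R, 0 < c /\ [/\ h x0 = c *: g x0, continuous (fun t => h (z t)),
        vec_lbm (fun t => h (z t)) &
        forall s, 0 <= s -> z s = x0 + vint (fun t => h (z t)) 0 s]].
Proof.
move=> gF; have [z [z1 z2 z3]] := bounded_autonomous_solution x0 h_continuous h_le1.
have [T [x [xmax xz]]] := time_changed_trajectory z1 z2 z3 gF.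
exists T, x, z, h; split => //.
  move=> s s0; have := @integral_lipschitz R n x0 (fun t => h (z t)) z s 1 z2
    (fun t _ => h_le1 (z t)) z3 0 s (lexx 0) s0 (lexx s).
  by rewrite mul1r subr0 (z3 0)// vintxx addr0.
exists (w x0); split => //; split => //.
exact: (continuous_along z1 h_continuous).
Qed.

End time_change.

Section necessity.
Context {R : realType} {n : nat}.
Notation vec := 'rV[R]_n.

(** The estimate is made along [z], which visits only points of the trajectory, has speed at most 1
    and a continuous velocity; its initial velocity is a positive multiple of [v], so the sign is
    unaffected. *)
Lemma strong_invariance_necessary (F : vec -> set vec) (S : set vec) (x p v : vec) :
  multi_lsc F -> (forall x, convex_set (F x)) -> (forall x, closed (F x)) ->
  (forall x, F x !=set0) -> strongly_invariant F S -> S x -> proximal_normal S x p ->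
  F x v -> dot p v <= 0.
Proof.
move=> F_lsc F_convex F_closed F0 FS Sx [c c0 cP] Fv.
have [g [cg gF gx]] := selection_through F_lsc F_convex F_closed F0 Fv.
have [T [y [z [h [ymax yz zlip [k [k0 [hx ch hl zE]]]]]]]] := exists_maximal_trajectory x cg gF.
have Sz s : 0 <= s -> S (z s).
  by move=> s0; have [t [t0 tT] <-] := yz s s0; exact: FS ymax _ _ _.
have z0 : z 0 = x by rewrite zE// vintxx addr0.
rewrite leNgt; apply/negP => pv.
have pc : continuous (fun t => dot p (h (z t))).
  move=> t; apply: (@cvg_comp _ _ _ (fun t => h (z t)) (dot p) (nbhs t) (nbhs (h (z t)))).
    exact: ch.
  exact: dot_continuousr.
set d := dot p (h (z 0)) / 2.
have d0 : 0 < d by rewrite /d z0 hx dotZr gx divr_gt0// mulr_gt0.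
have [r /= r0 rP] : nbhs_ball (0 : R) (fun t => d < dot p (h (z t))).
  apply/nbhs_ballP; have := pc 0 => /cvgrPdist_lt/(_ d d0); apply: filterS => t.
  by rewrite ltr_norml /d => /andP[_]; lra.
(* The first bound keeps [0, s] where the inner product exceeds [d]. The second makes the quadratic
   upper bound [c * (n%:R * s) ^+ 2] smaller than the linear lower bound [s * d]; the added 1 keeps
   the divisor positive. *)
pose s : R := Num.min (r / 2) (d / (c * n%:R ^+ 2 + 1)).
have cn : 0 < c * n%:R ^+ 2 + 1 by rewrite ltr_wpDl// mulr_ge0 ?(ltW c0)// sqr_ge0.
have s0 : 0 < s by rewrite lt_min; apply/andP; split; apply: divr_gt0.
have sr : s < r by rewrite gt_min; apply/orP; left; lra.
have lower : s * d <= dot p (z s - x).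
  rewrite (zE _ (ltW s0)) addrC addKr -[leRHS]opprK lerNr -dotNl -mulrN -[X in X * _]subr0.
  apply: dot_vint_le => //; first exact: ltW.
  move=> t /andP[t0 ts]; rewrite dotNl lerN2 ltW//; apply: rP.
  suff : `|0 - t| < r by [].
  by rewrite sub0r normrN ger0_norm// (le_lt_trans ts).
have := cP (z s) (Sz s (ltW s0)).
have zs := zlip s (ltW s0).
have es : enorm (z s - x) <= n%:R * s.
  by rewrite (le_trans (enorm_le_norm _))// ler_wpM2l.
have es2 : enorm (z s - x) ^+ 2 <= (n%:R * s) ^+ 2.
  by rewrite ler_pXn2r ?nnegrE ?sqrtr_ge0 ?mulr_ge0 ?(ltW s0).
have : c * enorm (z s - x) ^+ 2 <= s * (c * n%:R ^+ 2 * s).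
  rewrite (_ : s * _ = c * (n%:R * s) ^+ 2); last by ring.
  by rewrite ler_pM2l.
have : c * n%:R ^+ 2 * s < d.
  rewrite (@lt_le_trans _ _ ((c * n%:R ^+ 2 + 1) * s))//; first by rewrite ltr_pM2r// ltrDl.
  by rewrite mulrC -ler_pdivlMr// ge_min lexx orbT.
move=> h1; have : s * (c * n%:R ^+ 2 * s) < s * d by rewrite ltr_pM2l.
lra.
Qed.

End necessity.

Theorem theorem3 (R : realType) (n : nat) (F : 'rV[R]_n -> set 'rV[R]_n)
    (S : set 'rV[R]_n)
    (F_U : conditionU F)
    (F_lsc : multi_lsc F)
    (F_closed : forall x, closed (F x))
    (F_convex : forall x, convex_set (F x))
    (F_nonempty : forall x, F x !=set0)
    (S_closed : closed S) :
  strongly_invariant F S <->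
  (forall x, boundary S x ->
     forall p, proximal_normal S x p -> (hamiltonian F x p <= 0)%E).
Proof.
have closureS x : closure S x -> S x by rewrite -(closure_id S).1.
split => [FS x [clSx _] p pN|H].
  apply: ge_ereal_sup => _ [v Fv <-]; rewrite lee_fin dotC.
  exact: (strong_invariance_necessary F_lsc F_convex F_closed F_nonempty FS
    (closureS x clSx) pN Fv).
apply: strong_invariance_sufficient => // x p v Sx pN Fv.
(* The hypothesis covers the boundary, and in the interior the only proximal normal is 0; aiming
   needs the inequality on all of [S]. *)
have [Six|nSix] := pselect (interior S x).
  by rewrite (proximal_normal_interior Six pN) /dot big1// => i _; rewrite mxE mul0r.
have Sbx : boundary S x by split => //; exact: subset_closure.
rewrite dotC -lee_fin; apply: le_trans (H x Sbx p pN).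
by apply: ereal_sup_ubound; exists v.
Qed.
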